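(* Let $\mathfrak g=gl(m|n)$ and let $\chi\in\mathfrak g_{\bar 0}^*$ be semisimple. If $\chi(h_\alpha)\neq 0$ for every $\alpha\in\Phi_1^+$, then $Z^{\chi}(M)$ is simple for every simple $u(\mathfrak g_{\bar 0},\chi)$-module $M$.
   Context: $\mathbf F$ is an algebraically closed field of characteristic $p>3$, $(m,n)\neq(1,1)$, and $\mathfrak g=gl(m|n)$ is the restricted Lie superalgebra with matrix units $e_{ij}$, $1\le i,j\le m+n$, with $\mathfrak g_{\bar 0}=gl(m)\oplus gl(n)$ and $p$-mapping the $p$-th matrix power. $\mathfrak g_1=\bigoplus_{i\le m<j}\mathbf Fe_{ij}$, $\mathfrak g_{-1}=\bigoplus_{i\le m<j}\mathbf Fe_{ji}$, $\mathfrak g^+=\mathfrak g_{\bar 0}+\mathfrak g_1$, $H=\langle e_{ii}\rangle$. $\Phi_1^+$ is the set of positive odd roots $\alpha=\epsilon_i-\delta_j$ ($1\le i\le m$, $1\le j\le n$), with $h_\alpha=e_{ii}+e_{m+j,m+j}$. $\chi\in\mathfrak g_{\bar 0}^*$ is semisimple if $\chi$ vanishes on all even root vectors $e_{ij}\in\mathfrak g_{\bar 0}$, $i\ne j$. $u(\mathfrak g,\chi)$ is the quotient of $U(\mathfrak g)$ by the two-sided ideal generated by $x^p-x^{[p]}-\chi(x)^p1$, $x\in\mathfrak g_{\bar 0}$; similarly for $u(\mathfrak g_{\bar 0},\chi)$ and $u(\mathfrak g^+,\chi)$. A simple $u(\mathfrak g_{\bar 0},\chi)$-module $M$ is regarded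 as a $u(\mathfrak g^+,\chi)$-module with $\mathfrak g_1M=0$, and $Z^{\chi}(M)=u(\mathfrak g,\chi)\otimes_{u(\mathfrak g^+,\chi)}M$. Simple means having no proper nonzero $\mathbf Z_2$-graded submodule. *)

(* Defs.v *)
From HB Require Import structures.
From mathcomp Require Import all_boot all_order all_algebra.
From mathcomp Require Import boolp finmap monalg.

Set Implicit Arguments.
Unset Strict Implicit.
Unset Printing Implicit Defensive.

Import GRing.Theory.

Local Open Scope ring_scope.

(* The quotients below are characterized by a surjective morphism (with a     *)
(* section) and its kernel; their construction is opaque on purpose, since    *)
(* unfolding it makes unification on iterated quotients very slow.            *)

Section ZQuot.
Variables (V : zmodType) (S : V -> Prop).

Inductive zspan : V -> Prop :=
| zspan0 : zspan 0
| zspan_gen s : S s -> zspan s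
| zspanB x y : zspan x -> zspan y -> zspan (x - y).

Record zquot_data := ZQuotData {
  zq_sort : zmodType;
  zq_proj : {additive V -> zq_sort};
  zq_repr : zq_sort -> V;
  zq_reprK : cancel zq_repr zq_proj;
  zq_ker : forall x, zq_proj x = 0 <-> zspan x }.

Definition zspan_pred : {pred V} := fun x => `[< zspan x >].

Fact zspan_closed : zmod_closed zspan_pred.
Proof.
split; first by apply/asboolP; exact: zspan0.
by move=> x y /asboolP zx /asboolP zy; apply/asboolP; exact: zspanB.
Qed.
HB.instance Definition _ := GRing.isZmodClosed.Build V zspan_pred zspan_closed.

Lemma zquot_subproof : zquot_data.
Proof.
pose Q := Quotient.quot (zspan_pred : zmodClosed V).
pose f : {additive V -> Q} := \pi_Q%qT.
apply: (@ZQuotData _ f (@repr _ Q)); first exact: reprK.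
move=> x; rewrite -(raddf0 f) /f; split=> [/eqP|h].
  by rewrite -Quotient.idealrBE subr0 => /asboolP.
by apply/eqP; rewrite -Quotient.idealrBE subr0; apply/asboolP.
Qed.

Definition zquot : zmodType := zq_sort zquot_subproof.
Definition zproj : {additive V -> zquot} := zq_proj zquot_subproof.
Definition zrepr : zquot -> V := @zq_repr zquot_subproof.

Lemma zreprK : cancel zrepr zproj.
Proof. exact: zq_reprK. Qed.

Lemma zproj_ker x : zproj x = 0 <-> zspan x.
Proof. exact: zq_ker. Qed.

Lemma zproj_eq x y : zproj x = zproj y <-> zspan (x - y).
Proof.
rewrite -zproj_ker raddfB; split=> [->|/eqP]; first by rewrite subrr.
by rewrite subr_eq0 => /eqP.
Qed.
End ZQuot.

Lemma zspan_sub (V W : zmodType) (S : V -> Prop) (T : W -> Prop)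
    (f : {additive V -> W}) :
  (forall s, S s -> zspan T (f s)) -> forall x, zspan S x -> zspan T (f x).
Proof.
move=> h x; elim=> [|s /h//|y z _ hy _ hz]; first by rewrite raddf0; exact: zspan0.
by rewrite raddfB; exact: zspanB.
Qed.

Section RQuot.
Variables (A : pzRingType) (S : A -> Prop).

(* The two-sided ideal generated by S is [zspan ideal_gen].                   *)
Definition ideal_gen (x : A) : Prop := exists a s b, S s /\ x = a * s * b.

Lemma idealMl a x : zspan ideal_gen x -> zspan ideal_gen (a * x).
Proof.
elim=> [|_ [b [s [c [Ss ->]]]]|y z _ hy _ hz].
- by rewrite mulr0; exact: zspan0.
- by apply: zspan_gen; exists (a * b), s, c; rewrite !mulrA.
- by rewrite mulrBr; exact: zspanB.
Qed.

Lemma idealMr a x : zspan ideal_gen x -> zspan ideal_gen (x * a).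
Proof.
elim=> [|_ [b [s [c [Ss ->]]]]|y z _ hy _ hz].
- by rewrite mul0r; exact: zspan0.
- by apply: zspan_gen; exists b, s, (c * a); rewrite !mulrA.
- by rewrite mulrBl; exact: zspanB.
Qed.

(* The quotient may be the zero ring, hence only a [pzRingType].              *)
Record rquot_data := RQuotData {
  rq_sort : pzRingType;
  rq_proj : {rmorphism A -> rq_sort};
  rq_repr : rq_sort -> A;
  rq_reprK : cancel rq_repr rq_proj;
  rq_ker : forall x, rq_proj x = 0 <-> zspan ideal_gen x }.

Definition rquot_sort : Type := zquot ideal_gen.
Local Notation Q := rquot_sort.
HB.instance Definition _ := GRing.Zmodule.on Q.
Definition rquot_proj : A -> Q := zproj ideal_gen.
Local Notation pr := rquot_proj.
Definition rquot_mul (x y : Q) : Q := pr (zrepr x * zrepr y).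
Local Notation mul := rquot_mul.

Let prK : cancel (@zrepr _ ideal_gen) pr. Proof. exact: zreprK. Qed.
Let prB : zmod_morphism pr. Proof. exact: raddfB. Qed.
Let prD : {morph pr : x y / x + y}. Proof. exact: raddfD. Qed.

Let prM x y : mul (pr x) (pr y) = pr (x * y).
Proof.
have rep z : zspan ideal_gen (zrepr (pr z) - z).
  by apply/zproj_eq; rewrite -/rquot_proj prK.
apply/zproj_eq; rewrite -(subrK (zrepr (pr x) * y) (_ * _)) -addrA -mulrBr -mulrBl.
rewrite -[X in zspan _ (_ + X)]opprK; apply: zspanB; first exact/idealMl/rep.
by rewrite -[- _]sub0r; apply: zspanB; [exact: zspan0 | exact/idealMr/rep].
Qed.

Let qmulA : associative mul.
Proof. by move=> x y z; rewrite -(prK x) -(prK y) -(prK z) !prM mulrA. Qed.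
Let qmul1 : left_id (pr 1) mul.
Proof. by move=> x; rewrite -(prK x) !prM mul1r. Qed.
Let qmulr1 : right_id (pr 1) mul.
Proof. by move=> x; rewrite -(prK x) !prM mulr1. Qed.
Let qmulDl : left_distributive mul +%R.
Proof.
by move=> x y z; rewrite -(prK x) -(prK y) -(prK z) -prD !prM mulrDl prD.
Qed.
Let qmulDr : right_distributive mul +%R.
Proof.
by move=> x y z; rewrite -(prK x) -(prK y) -(prK z) -prD !prM mulrDr prD.
Qed.
HB.instance Definition _ :=
  GRing.Zmodule_isPzRing.Build Q qmulA qmul1 qmulr1 qmulDl qmulDr.

Let pr_is_monoid : monoid_morphism pr.
Proof. by split=> // x y; rewrite -prM. Qed.
HB.instance Definition _ := GRing.isZmodMorphism.Build A Q pr prB.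
HB.instance Definition _ := GRing.isMonoidMorphism.Build A Q pr pr_is_monoid.

Lemma rquot_subproof : rquot_data.
Proof. exact: (@RQuotData Q pr _ prK (@zproj_ker _ _)). Qed.

Definition rquot : pzRingType := rq_sort rquot_subproof.
Definition rproj : {rmorphism A -> rquot} := rq_proj rquot_subproof.
Definition rrepr : rquot -> A := @rq_repr rquot_subproof.

Lemma rreprK : cancel rrepr rproj.
Proof. exact: rq_reprK. Qed.

Lemma rproj_ker x : rproj x = 0 <-> zspan ideal_gen x.
Proof. exact: rq_ker. Qed.

Lemma rproj_gen s : S s -> rproj s = 0.
Proof.
by move=> Ss; apply/rproj_ker/zspan_gen; exists 1, s, 1; rewrite mul1r mulr1.
Qed.

Section Lift.
Variables (C : pzRingType) (f : {rmorphism A -> C}).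
Hypothesis f0 : forall s, S s -> f s = 0.

Definition rlift_fun (_ : forall s, S s -> f s = 0) (x : rquot) : C :=
  f (rrepr x).

Lemma ideal_lift0 x : zspan ideal_gen x -> f x = 0.
Proof.
elim=> [|_ [a [s [b [/f0 fs ->]]]]|y z _ hy _ hz]; first exact: rmorph0.
  by rewrite !rmorphM /= fs mulr0 mul0r.
by rewrite rmorphB hy hz subrr.
Qed.

Lemma rlift_funE x : rlift_fun f0 (rproj x) = f x.
Proof.
apply/eqP; rewrite -subr_eq0 -rmorphB; apply/eqP/ideal_lift0/rproj_ker.
by rewrite rmorphB rreprK subrr.
Qed.

Fact rlift_is_zmod : zmod_morphism (rlift_fun f0).
Proof.
by move=> x y; rewrite -(rreprK x) -(rreprK y) -rmorphB !rlift_funE rmorphB.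
Qed.
Fact rlift_is_monoid : monoid_morphism (rlift_fun f0).
Proof.
split; first by rewrite -(rmorph1 rproj) rlift_funE rmorph1.
by move=> x y; rewrite -(rreprK x) -(rreprK y) -rmorphM !rlift_funE rmorphM.
Qed.
HB.instance Definition _ :=
  GRing.isZmodMorphism.Build rquot C (rlift_fun f0) rlift_is_zmod.
HB.instance Definition _ :=
  GRing.isMonoidMorphism.Build rquot C (rlift_fun f0) rlift_is_monoid.

Definition rlift : {rmorphism rquot -> C} := rlift_fun f0.
Lemma rliftE x : rlift (rproj x) = f x.
Proof. exact: rlift_funE. Qed.
End Lift.
End RQuot.

(* Free associative algebras over a field: noncommutative polynomials.        *)

Definition free_alg (F : fieldType) (X : choiceType) : pzRingType :=
  {malg F[{fmonom X}]}.
HB.lock Definition letter (F : fieldType) (X : choiceType) (x : X) : free_alg F X :=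
  << (1 : F) *g fmu x >>.
Definition free_scal (F : fieldType) (X : choiceType) :
  {rmorphism F -> free_alg F X} := @malgC {fmonom X} F.
Arguments letter F {X} x.
Arguments free_scal F X : clear implicits.

Section FreeLift.
Variables (F : fieldType) (X : choiceType) (S : pzRingType).
Variables (f : {rmorphism F -> S}) (h : X -> S).
Local Notation P := {malg F[{fmonom X}]}.
Hypothesis fC : forall c s, f c * s = s * f c.

Definition free_lift_fun (_ : forall c s, f c * s = s * f c) (g : P) : S :=
  \sum_(w <- msupp g) f g@_w * \prod_(x <- (w : seq X)) h x.

Local Notation word w := (\prod_(x <- (w : seq X)) h x).

Lemma free_liftEw (d : {fset {fmonom X}}) g : (msupp g `<=` d)%fset ->
  free_lift_fun fC g = \sum_(w <- d) f g@_w * word w.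
Proof.
move=> le; rewrite [LHS](big_fset_incl _ le) => //= x xd /mcoeff_outdom ->.
by rewrite raddf0 mul0r.
Qed.

Lemma free_lift_funU c w : free_lift_fun fC << c *g w >> = f c * word w.
Proof. by rewrite (free_liftEw msuppU_le) big_seq_fset1 mcoeffUU. Qed.

Fact free_lift_is_zmod : zmod_morphism (free_lift_fun fC).
Proof.
move=> g1 g2; pose d := (msupp g1 `|` msupp g2)%fset.
rewrite (@free_liftEw d) ?msuppB_le // (@free_liftEw d g1) ?fsubsetUl //.
rewrite (@free_liftEw d g2) ?fsubsetUr // -sumrB; apply: eq_bigr => w _.
by rewrite mcoeffB raddfB mulrBl.
Qed.
HB.instance Definition _ :=
  GRing.isZmodMorphism.Build P S (free_lift_fun fC) free_lift_is_zmod.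

Fact free_lift_is_monoid : monoid_morphism (free_lift_fun fC).
Proof.
split; first by rewrite -[1]/(<< 1 *g _ >>) free_lift_funU fm1 big_nil mulr1 rmorph1.
move=> g1 g2; rewrite malgME raddf_sum mulr_suml /=; apply: eq_bigr=> i _.
rewrite raddf_sum mulr_sumr /=; apply: eq_bigr=> j _.
by rewrite free_lift_funU rmorphM fmM big_cat /= -!mulrA; congr (_ * _); rewrite !mulrA fC.
Qed.
HB.instance Definition _ :=
  GRing.isMonoidMorphism.Build P S (free_lift_fun fC) free_lift_is_monoid.

Definition free_lift : {rmorphism free_alg F X -> S} := free_lift_fun fC.

Lemma free_liftL x : free_lift (letter F x) = h x.
Proof. by rewrite letter.unlock [LHS]free_lift_funU fmU big_seq1 rmorph1 mul1r. Qed.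
Lemma free_liftC c : free_lift (free_scal F X c) = f c.
Proof. by rewrite [LHS]free_lift_funU fm1 big_nil mulr1. Qed.
End FreeLift.

Lemma free_scalC (F : fieldType) (X : choiceType) (c : F) (g : free_alg F X) :
  free_scal F X c * g = g * free_scal F X c.
Proof.
have h (q : {malg F[{fmonom X}]}) : c%:MP * q = q * c%:MP.
  rewrite (monalgE q) mulr_suml mulr_sumr; apply: eq_bigr => w _.
  rewrite (malgMEw msuppU_le msuppU_le) (malgMEw msuppU_le msuppU_le).
  by rewrite !big_seq_fset1 !mcoeffUU mul1m mulm1 mulrC.
exact: h.
Qed.

(* Modules: restriction of scalars, tensor products, gradings.                *)

Definition restrict (B A : pzRingType) (f : {rmorphism B -> A}) (M : lmodType A)
  : Type := M.

Section Restrict.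
Variables (B A : pzRingType) (f : {rmorphism B -> A}) (M : lmodType A).

HB.instance Definition _ := GRing.Zmodule.copy (restrict f M) M.

Definition restrict_scale (b : B) (v : restrict f M) : restrict f M :=
  f b *: (v : M).

Fact restrict_scaleA a b v :
  restrict_scale a (restrict_scale b v) = restrict_scale (a * b) v.
Proof. by rewrite /restrict_scale scalerA rmorphM. Qed.
Fact restrict_scale1 : left_id 1 restrict_scale.
Proof. by move=> v; rewrite /restrict_scale rmorph1 scale1r. Qed.
Fact restrict_scaleDr : right_distributive restrict_scale +%R.
Proof. by move=> b v w; rewrite /restrict_scale -scalerDr. Qed.
Fact restrict_scaleDl v : {morph restrict_scale^~ v : a b / a + b}.
Proof. by move=> a b; rewrite /restrict_scale rmorphD -scalerDl. Qed.

HB.instance Definition _ := GRing.Zmodule_isLmodule.Build B (restrict f M)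
  restrict_scaleA restrict_scale1 restrict_scaleDr restrict_scaleDl.
End Restrict.

(* A (x)_B M, where A is a right B-module through f. The additive group       *)
(* {malg A[M]} is A (x)_Z Z[M]: the symbol <<a *g v>> is additive in a, and   *)
(* the remaining tensor relations are imposed on it.                          *)
Section Tensor.
Variables (B A : pzRingType) (f : {rmorphism B -> A}) (M : lmodType B).

Inductive tensor_rel : {malg A[M]} -> Prop :=
| tensor_relD a v w :
    tensor_rel (<< a *g v + w >> - (<< a *g v >> + << a *g w >>))
| tensor_relM a b v :
    tensor_rel (<< a * f b *g v >> - << a *g b *: v >>).

Definition tensor_sort : Type := zquot tensor_rel.
HB.instance Definition _ := GRing.Zmodule.on tensor_sort.

Definition free_scale (a : A) (g : {malg A[M]}) : {malg A[M]} :=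
  \sum_(v <- msupp g) << a * g@_v *g v >>.

Lemma free_scaleE a g v : (free_scale a g)@_v = a * g@_v.
Proof.
rewrite {2}[g]monalgE !raddf_sum mulr_sumr.
by apply/eq_bigr=> /= i _; rewrite !mcoeffU mulrnAr.
Qed.

Lemma free_scaleU a b v : free_scale a << b *g v >> = << a * b *g v >>.
Proof. by apply/malgP=> w; rewrite free_scaleE !mcoeffU mulrnAr. Qed.

Fact free_scale_is_zmod a : zmod_morphism (free_scale a).
Proof.
by move=> g1 g2; apply/malgP=> v; rewrite !(mcoeffB, free_scaleE) mulrBr.
Qed.
HB.instance Definition _ a :=
  GRing.isZmodMorphism.Build {malg A[M]} {malg A[M]} (free_scale a)
    (free_scale_is_zmod a).

Lemma tensor_span_scale a g :
  zspan tensor_rel g -> zspan tensor_rel (free_scale a g).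
Proof.
have sB x y : free_scale a (x - y) = free_scale a x - free_scale a y by exact: raddfB.
have sD x y : free_scale a (x + y) = free_scale a x + free_scale a y by exact: raddfD.
apply: zspan_sub => _ [b v w|b c v]; rewrite /= sB.
  by rewrite sD !free_scaleU; apply: zspan_gen; apply: tensor_relD.
by rewrite !free_scaleU mulrA; apply: zspan_gen; apply: tensor_relM.
Qed.

Definition tensor_scale (a : A) (t : tensor_sort) : tensor_sort :=
  zproj tensor_rel (free_scale a (zrepr t)).

Lemma tensor_scaleE a g :
  tensor_scale a (zproj tensor_rel g) = zproj tensor_rel (free_scale a g).
Proof.
apply/zproj_eq; rewrite -raddfB; apply: tensor_span_scale.
by apply/zproj_eq; rewrite zreprK.
Qed.

Fact tensor_scaleA a b t :
  tensor_scale a (tensor_scale b t) = tensor_scale (a * b) t.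
Proof.
rewrite -(zreprK t); rewrite !tensor_scaleE; congr (zproj _ _).
by apply/malgP=> v; rewrite !free_scaleE mulrA.
Qed.
Fact tensor_scale1 : left_id 1 tensor_scale.
Proof.
move=> t; rewrite -(zreprK t); rewrite !tensor_scaleE; congr (zproj _ _).
by apply/malgP=> v; rewrite !free_scaleE mul1r.
Qed.
Fact tensor_scaleDr : right_distributive tensor_scale +%R.
Proof.
move=> a t u; rewrite -(zreprK t);rewrite -(zreprK u).
by rewrite -raddfD !tensor_scaleE -!raddfD.
Qed.
Fact tensor_scaleDl t : {morph tensor_scale^~ t : a b / a + b}.
Proof.
move=> a b; rewrite -(zreprK t); rewrite !tensor_scaleE -raddfD.
by congr (zproj _ _); apply/malgP=> v; rewrite mcoeffD !free_scaleE mulrDl.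
Qed.

HB.instance Definition _ := GRing.Zmodule_isLmodule.Build A tensor_sort
  tensor_scaleA tensor_scale1 tensor_scaleDr tensor_scaleDl.

Definition tensor : lmodType A := tensor_sort.
Definition tens (a : A) (v : M) : tensor := zproj tensor_rel << a *g v >>.

Lemma tensZ a b v : a *: tens b v = tens (a * b) v.
Proof. by rewrite /tens -[LHS]/(tensor_scale _ _) tensor_scaleE free_scaleU. Qed.
Lemma tensDl v : {morph tens^~ v : a b / a + b}.
Proof. by move=> a b; rewrite /tens monalgUD raddfD. Qed.
Lemma tensDr a : {morph tens a : v w / v + w}.
Proof.
by move=> v w; rewrite /tens -raddfD; apply/zproj_eq/zspan_gen; apply: tensor_relD.
Qed.
Lemma tensM a b v : tens (a * f b) v = tens a (b *: v).
Proof. by apply/zproj_eq/zspan_gen; apply: tensor_relM. Qed.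
End Tensor.

(* Gradings by Z/2 are given by their homogeneous parts, [dA true] being the  *)
(* odd one. A simple module is nonzero by convention.                         *)
Section Graded.
Variables (A : pzRingType) (dA : bool -> A -> Prop).
Variables (V : lmodType A) (dV : bool -> V -> Prop).

Definition graded_module : Prop :=
  [/\ forall a, dV a 0 /\ (forall v w, dV a v -> dV a w -> dV a (v - w)),
      forall v, exists v0 v1, [/\ dV false v0, dV true v1 & v = v0 + v1],
      forall v, dV false v -> dV true v -> v = 0
    & forall a b x v, dA a x -> dV b v -> dV (a (+) b) (x *: v)].

Definition graded_submodule (N : V -> Prop) : Prop :=
  [/\ N 0, forall v w, N v -> N w -> N (v + w),
      forall x v, N v -> N (x *: v)
    & forall v, N v -> exists v0 v1,
        [/\ dV false v0 /\ N v0, dV true v1 /\ N v1 & v = v0 + v1]].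

Definition graded_simple : Prop :=
  (exists v : V, v <> 0) /\
  forall N, graded_submodule N ->
    (forall v, N v -> v = 0) \/ (forall v, N v).
End Graded.

Inductive tensor_par (B A : pzRingType) (f : {rmorphism B -> A})
    (M : lmodType B) (dA : bool -> A -> Prop) (dM : bool -> M -> Prop) :
    bool -> tensor f M -> Prop :=
| tensor_par0 a : tensor_par dA dM a 0
| tensor_parD a t u :
    tensor_par dA dM a t -> tensor_par dA dM a u -> tensor_par dA dM a (t + u)
| tensor_par_tens a b x v :
    dA a x -> dM b v -> tensor_par dA dM (a (+) b) (tens f x v).

(* The Lie superalgebra gl(m|n): an index i : 'I_(m + n) is even if i < m, and *)
(* [unit_span P] is the span of the matrix units e_ij with P i j.             *)

Section GL.
Variables (F : fieldType) (m n : nat).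
Local Notation g := 'M[F]_(m + n).

Definition unit_span (P : rel 'I_(m + n)) : {vspace g} :=
  (\sum_(ij : 'I_(m + n) * 'I_(m + n) | P ij.1 ij.2) <[delta_mx ij.1 ij.2]>)%VS.

Definition gl_even := unit_span (fun i j => (i < m)%N == (j < m)%N).
Definition gl_up := unit_span (fun i j => (i < m <= j)%N).
Definition gl_down := unit_span (fun i j => (j < m <= i)%N).
Definition gl_par (a : bool) := if a then (gl_up + gl_down)%VS else gl_even.
Definition gl_plus := (gl_even + gl_up)%VS.

(* The superbracket of x and y, homogeneous of parities a and b.              *)
Definition sbracket (a b : bool) (x y : g) : g :=
  x *m y - (-1) ^+ (a && b) *: (y *m x).

Lemma mem_unit_span P (x : g) :
  reflect (forall i j, ~~ P i j -> x i j = 0) (x \in unit_span P).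
Proof.
apply: (iffP idP) => [|x0].
  case/memv_sumP=> y yP -> i j nPij; rewrite summxE big1 // => -[k l] /= Pkl.
  have /vlineP[c ->] := yP (k, l) Pkl; rewrite !mxE.
  by case: eqP => [ei|]; case: eqP => [ej|]; rewrite ?mulr0 //; move: nPij; rewrite ei ej Pkl.
rewrite (matrix_sum_delta x) pair_big /=; apply: memv_suml => -[i j] _ /=.
have [Pij|/x0->] := boolP (P i j); last by rewrite scale0r mem0v.
by apply/memvZ; apply: (subvP (sumv_sup (i, j) _ (subvv _))) => //; exact: memv_line.
Qed.

(* h_alpha for the odd root alpha = epsilon_i - delta_j.                      *)
Definition h_root (i : 'I_m) (j : 'I_n) : g :=
  delta_mx (lshift n i) (lshift n i) + delta_mx (rshift m j) (rshift m j).

Lemma delta_gl_even (i j : 'I_(m + n)) : ((i < m)%N == (j < m)%N) ->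
  delta_mx i j \in gl_even.
Proof.
move=> e; apply/mem_unit_span => k l /=; rewrite mxE.
by case: (eqVneq k i) => [->|//]; case: (eqVneq l j) => [->|//]; rewrite e.
Qed.

Lemma h_root_gl_even i j : h_root i j \in gl_even.
Proof. by apply: memvD; apply: delta_gl_even; rewrite eqxx. Qed.
End GL.

(* U(L) and u(L, chi), for L one of the subalgebras gl_even, gl_plus or the   *)
(* whole of gl(m|n). U(L) is the free algebra on the set L modulo linearity   *)
(* of the generators (which gives the tensor algebra) and the superbracket    *)
(* relations; u(L, chi) is the quotient of U(L) by x^p - x^[p] - chi(x)^p.    *)

Section MorphRel.
Variables (A B : pzRingType) (e : {rmorphism A -> B}).
Lemma morph_linear c x y z :
  e (z - (c * x + y)) = e z - (e c * e x + e y).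
Proof. by rewrite rmorphB rmorphD rmorphM. Qed.
Lemma morph_bracket (b : bool) x y z :
  e (x * y - (-1) ^+ b * (y * x) - z)
  = e x * e y - (-1) ^+ b * (e y * e x) - e z.
Proof. by rewrite !rmorphB !rmorphM rmorph_sign. Qed.
Lemma morph_pow p x y z : e (x ^+ p - y - z) = e x ^+ p - e y - e z.
Proof. by rewrite !rmorphB rmorphXn. Qed.
End MorphRel.

Section Envelop.
Variables (F : fieldType) (m n : nat) (L : {vspace 'M[F]_(m + n)}).
Local Notation T := (free_alg F (subvs_of L)).

Inductive env_rel : T -> Prop :=
| env_linear c x y :
    env_rel (letter F (c *: x + y) - (free_scal F _ c * letter F x + letter F y))
| env_bracket a b (x y z : subvs_of L) :
    vsval x \in gl_par F m n a -> vsval y \in gl_par F m n b ->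
    vsval z = sbracket a b (vsval x) (vsval y) ->
    env_rel (letter F x * letter F y
             - (-1) ^+ (a && b) * (letter F y * letter F x) - letter F z).

Definition envelop : pzRingType := rquot env_rel.

Definition env_gen (x : subvs_of L) : envelop := rproj env_rel (letter F x).
Definition env_scal (c : F) : envelop := rproj env_rel (free_scal F _ c).

Variables (p : nat) (chi : {scalar subvs_of (gl_even F m n)}).

Inductive red_rel : envelop -> Prop :=
| red_pow (x0 : subvs_of (gl_even F m n)) (x xp : subvs_of L) :
    vsval x = vsval x0 -> vsval xp = vsval x0 ^+ p ->
    red_rel (env_gen x ^+ p - env_gen xp - env_scal (chi x0 ^+ p)).

Definition redenv : pzRingType := rquot red_rel.

Definition red_gen (x : subvs_of L) : redenv := rproj red_rel (env_gen x).
Definition red_scal : {rmorphism F -> redenv} :=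
  rproj red_rel \o (rproj env_rel \o free_scal F _).

(* The grading of u(L, chi) induced by that of L.                             *)
Inductive red_par : bool -> redenv -> Prop :=
| red_par0 a : red_par a 0
| red_par_scal c : red_par false (red_scal c)
| red_par_gen a (x : subvs_of L) :
    vsval x \in gl_par F m n a -> red_par a (red_gen x)
| red_parD a u v : red_par a u -> red_par a v -> red_par a (u + v)
| red_parM a b u v : red_par a u -> red_par b v -> red_par (a (+) b) (u * v).

Lemma red_scalC c u : red_scal c * u = u * red_scal c.
Proof.
rewrite -(rreprK u) -(rreprK (rrepr u)) /red_scal /= -!rmorphM /=.
by rewrite free_scalC.
Qed.

Lemma red_gen_linear c x y :
  red_gen (c *: x + y) = red_scal c * red_gen x + red_gen y.
Proof.
apply/eqP; rewrite -subr_eq0; apply/eqP.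
have := rproj_gen (env_linear c x y); rewrite morph_linear.
by move=> /(congr1 (rproj red_rel)); rewrite morph_linear rmorph0.
Qed.

Lemma red_gen_bracket a b (x y z : subvs_of L) :
  vsval x \in gl_par F m n a -> vsval y \in gl_par F m n b ->
  vsval z = sbracket a b (vsval x) (vsval y) ->
  red_gen x * red_gen y - (-1) ^+ (a && b) * (red_gen y * red_gen x) = red_gen z.
Proof.
move=> hx hy hz; apply/eqP; rewrite -subr_eq0; apply/eqP.
have := rproj_gen (env_bracket hx hy hz); rewrite morph_bracket.
by move=> /(congr1 (rproj red_rel)); rewrite morph_bracket rmorph0.
Qed.

Lemma red_gen_pow (x0 : subvs_of (gl_even F m n)) (x xp : subvs_of L) :
  vsval x = vsval x0 -> vsval xp = vsval x0 ^+ p ->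
  red_gen x ^+ p = red_gen xp + red_scal (chi x0 ^+ p).
Proof.
move=> hx hxp; apply/eqP; rewrite -subr_eq0 opprD addrA; apply/eqP.
by have := rproj_gen (red_pow hx hxp); rewrite morph_pow.
Qed.

(* Universal property of u(L, chi).                                           *)
Section Lift.
Variables (S : pzRingType) (f : {rmorphism F -> S}) (h : subvs_of L -> S).

Record red_rep : Prop := RedRep {
  rep_scalC : forall c s, f c * s = s * f c;
  rep_linear : forall c x y, h (c *: x + y) = f c * h x + h y;
  rep_bracket : forall a b (x y z : subvs_of L),
    vsval x \in gl_par F m n a -> vsval y \in gl_par F m n b ->
    vsval z = sbracket a b (vsval x) (vsval y) ->
    h x * h y - (-1) ^+ (a && b) * (h y * h x) = h z;
  rep_pow : forall (x0 : subvs_of (gl_even F m n)) (x xp : subvs_of L),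
    vsval x = vsval x0 -> vsval xp = vsval x0 ^+ p ->
    h x ^+ p = h xp + f (chi x0 ^+ p) }.

Hypothesis rep : red_rep.

Fact env_lift0 (s : T) : env_rel s -> free_lift h (rep_scalC rep) s = 0.
Proof.
case=> [c x y|a b x y z hx hy hz].
  by rewrite morph_linear !free_liftL free_liftC (rep_linear rep) subrr.
by rewrite morph_bracket !free_liftL (rep_bracket rep hx hy hz) subrr.
Qed.

Lemma env_lift_gen x : rlift env_lift0 (env_gen x) = h x.
Proof. by rewrite rliftE free_liftL. Qed.
Lemma env_lift_scal c : rlift env_lift0 (env_scal c) = f c.
Proof. by rewrite rliftE free_liftC. Qed.

Fact red_lift0 (s : envelop) : red_rel s -> rlift env_lift0 s = 0.
Proof.
case=> x0 x xp hx hxp; rewrite morph_pow !env_lift_gen env_lift_scal.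
by rewrite (rep_pow rep hx hxp) addrAC addrK subrr.
Qed.

Definition red_lift : {rmorphism redenv -> S} := rlift red_lift0.

Lemma red_lift_gen x : red_lift (red_gen x) = h x.
Proof. by rewrite /red_lift rliftE env_lift_gen. Qed.
Lemma red_lift_scal c : red_lift (red_scal c) = f c.
Proof. by rewrite /red_lift rliftE env_lift_scal. Qed.
End Lift.
End Envelop.

(* The canonical maps between reduced enveloping algebras, and Kac modules.   *)

Section Kac.
Variables (F : fieldType) (m n p : nat).
Variable chi : {scalar subvs_of (gl_even F m n)}.
Local Notation g := 'M[F]_(m + n).
Local Notation u L := (@redenv F m n L p chi).
Local Notation u_even := (u (gl_even F m n)).
Local Notation u_plus := (u (gl_plus F m n)).
Local Notation u_full := (u {:g}%VS).

Section Incl.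
Variables (L L' : {vspace g}) (LL' : (L <= L')%VS).

Definition incl (x : subvs_of L) : subvs_of L' := vsproj L' (vsval x).

Lemma vsval_incl x : vsval (incl x) = vsval x.
Proof. by rewrite vsprojK // (subvP LL') ?subvsP. Qed.

Fact incl_rep : red_rep p chi (red_scal L' p chi) (fun x => red_gen p chi (incl x)).
Proof.
split=> [c s|c x y|a b x y z hx hy hz|x0 x xp hx hxp].
- exact: red_scalC.
- rewrite -red_gen_linear; congr (red_gen _ _ _); apply: subvs_inj.
  by rewrite /incl linearP.
- by apply: red_gen_bracket; rewrite !vsval_incl.
- by apply: red_gen_pow; rewrite vsval_incl.
Qed.
Definition redenv_incl : {rmorphism u L -> u L'} := red_lift incl_rep.
End Incl.

(* The even part of x in gl_plus, i.e. its class modulo the ideal gl_up.      *)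
Definition even_part (x : g) : g :=
  \matrix_(i, j) (if (i < m)%N == (j < m)%N then x i j else 0).

Lemma even_part_even x : even_part x \in gl_even F m n.
Proof. by apply/mem_unit_span => i j /negbTE e; rewrite mxE e. Qed.

Lemma even_part_id x : x \in gl_even F m n -> even_part x = x.
Proof.
move/mem_unit_span=> x0; apply/matrixP=> i j; rewrite mxE.
by case: ifP => // /negbT /x0 ->.
Qed.

Lemma even_part_odd x : x \in gl_par F m n true -> even_part x = 0.
Proof.
case/memv_addP=> y /mem_unit_span y0 [z /mem_unit_span z0 ->].
apply/matrixP=> i j; rewrite !mxE; case: ifP => // /eqP e.
by rewrite y0 ?z0 ?addr0 //= [(m <= _)%N]leqNgt e andbN.
Qed.

Fact even_part_is_linear : linear even_part.
Proof.
by move=> c x y; apply/matrixP=> i j; rewrite !mxE; case: ifP; rewrite ?mulr0 ?addr0.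
Qed.
HB.instance Definition _ := GRing.isLinear.Build F g g _ even_part even_part_is_linear.

Lemma gl_plus0 x : x \in gl_plus F m n ->
  forall i j : 'I_(m + n), (j < m <= i)%N -> x i j = 0.
Proof.
case/memv_addP=> y /mem_unit_span y0 [z /mem_unit_span z0 ->] i j /andP[jm mi].
by rewrite mxE y0 ?z0 ?addr0 //= [(_ < m)%N]ltnNge mi ?jm.
Qed.

Lemma even_partM x y : x \in gl_plus F m n -> y \in gl_plus F m n ->
  even_part (x *m y) = even_part x *m even_part y.
Proof.
move=> /gl_plus0 x0 /gl_plus0 y0; apply/matrixP=> i j; rewrite !mxE.
case: ifP => [/eqP e|/eqP e]; last first.
  rewrite big1 // => k _; rewrite !mxE; case: ifP => [/eqP eik|_]; last by rewrite mul0r.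
  by case: ifP => [/eqP ekj|_]; rewrite ?mulr0 //; case: e; rewrite eik.
apply: eq_bigr => k _; rewrite !mxE -e [(k < m)%N == _]eq_sym; case: ifP => //.
case: (ltnP i m) e => im e; case: (ltnP k m) => km // _; rewrite mul0r.
  by rewrite (y0 k j) ?mulr0 // -e km.
by rewrite (x0 i k) ?mul0r // km.
Qed.

Definition even_proj (x : subvs_of (gl_plus F m n)) : subvs_of (gl_even F m n) :=
  vsproj _ (even_part (vsval x)).

Lemma vsval_even_proj x : vsval (even_proj x) = even_part (vsval x).
Proof. by rewrite vsprojK ?even_part_even. Qed.

Fact even_rep :
  red_rep p chi (red_scal (gl_even F m n) p chi) (fun x => red_gen p chi (even_proj x)).
Proof.
have par a x : vsval x \in gl_par F m n a -> vsval (even_proj x) \in gl_par F m n a.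
  rewrite vsval_even_proj; case: a => [/even_part_odd->|_]; first exact: mem0v.
  exact: even_part_even.
split=> [c s|c x y|a b x y z hx hy hz|x0 x xp hx hxp].
- exact: red_scalC.
- rewrite -red_gen_linear; congr (red_gen _ _ _); apply: subvs_inj.
  by rewrite /even_proj !linearP.
- apply: red_gen_bracket; rewrite ?par // !vsval_even_proj hz.
  by rewrite /sbracket linearB linearZ /= !even_partM ?subvsP.
- have pow_even k : vsval x0 ^+ k \in gl_even F m n.
    elim: k => [|k /mem_unit_span IH]; apply/mem_unit_span=> i j nij.
      by rewrite mxE; case: (eqVneq i j) nij => [->|//]; rewrite eqxx.
    rewrite exprS mxE big1 // => l _.
    have /mem_unit_span x00 := subvsP x0; have [e|/x00->] := boolP ((i < m)%N == (l < m)%N);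
      last by rewrite mul0r.
    by rewrite IH ?mulr0 // -(eqP e).
  apply: red_gen_pow; rewrite vsval_even_proj ?hx ?hxp even_part_id ?subvsP //.
Qed.
Definition redenv_even : {rmorphism u_plus -> u_even} := red_lift even_rep.

(* M as a u(gl_plus, chi)-module on which gl_up acts by 0.                    *)
Definition inflate (M : lmodType u_even) : lmodType u_plus := restrict redenv_even M.

Lemma inflate_up (M : lmodType u_even) x (v : inflate M) :
  vsval x \in gl_up F m n -> red_gen p chi x *: v = 0.
Proof.
move=> xo; rewrite -[LHS]/(redenv_even (red_gen p chi x) *: (v : M)) red_lift_gen.
have -> : even_proj x = 0.
  apply: subvs_inj; rewrite vsval_even_proj even_part_odd //.
  by apply: subvP xo; exact: addvSl.
have := red_gen_linear p chi (-1) 0 (0 : subvs_of (gl_even F m n)).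
by rewrite scaler0 addr0 rmorphN1 mulN1r addNr => ->; rewrite scale0r.
Qed.

Definition kac_module (M : lmodType u_even) : lmodType u_full :=
  tensor (redenv_incl (subvf (gl_plus F m n))) (inflate M).

Definition kac_par (M : lmodType u_even) (dM : bool -> M -> Prop) :
    bool -> kac_module M -> Prop :=
  @tensor_par _ _ _ (inflate M) (@red_par F m n {:g}%VS p chi) dM.

Definition semisimple_char : Prop :=
  forall i j : 'I_(m + n), i != j -> delta_mx i j \in gl_even F m n ->
    chi (vsproj _ (delta_mx i j)) = 0.
End Kac.

(* Main.v *)
(* The Kac module Z is spanned by the f_S (x) v, where f_S is a product of       *)
(* distinct odd negative root vectors f_a and v is in M. If z <> 0 lies in a    *)
(* submodule N, multiplying z by the f_a missing from a shortest term gives     *)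
(* f_top (x) v in N with v <> 0. As gl_even acts on f_top by a character, the   *)
(* v with f_top (x) v in N form a submodule of M, hence N contains f_top (x) M. *)
(* Take v to be a highest weight vector. Passing from v to f_top v one odd      *)
(* reflection at a time, each intermediate vector w is a highest weight vector  *)
(* for the current Borel subalgebra and e_a f_a w = h_a w = c w, where          *)
(* c^p - c = chi(h_a)^p is nonzero. So c <> 0, every step can be undone, and    *)
(* N contains 1 (x) v, hence all of Z.                                          *)
(* That 1 (x) v <> 0 is seen by mapping Z to the module coinduced from          *)
(* gl_down + gl_even, which is built by hand.                                   *)

From HB Require Import structures.
From mathcomp Require Import all_boot all_order all_algebra.
From mathcomp Require Import boolp functions finmap monalg.
From mathcomp Require Import zify ring.
Require Import Defs.

Set Implicit Arguments.
Unset Strict Implicit.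
Unset Printing Implicit Defensive.

Import GRing.Theory.

Local Open Scope ring_scope.

(** The submodule N is first pushed into the top exterior degree and then brought back to degree
    zero.

    Pushing up is formal. The letters f_a anticommute and square to zero, and commuting everything
    else past them shows that they generate Z from 1 (x) M ([kac_down_span], [kac_ext_span]). So a
    nonzero z can be multiplied up to some f_top (x) v with v nonzero ([ext_span_top]). Since
    gl_even acts on f_top by a character ([top_word_character]), the v with f_top (x) v in N are
    stable under u(gl_even, chi) ([top_stable]). That algebra is purely even, so graded simplicity
    of M applies to any stable subset ([simple_even_ungraded]), and N contains f_top (x) w for every
    w.

    Coming back uses the hypothesis on chi. Semisimplicity of chi makes the even root vectors
    nilpotent, and each e_kk satisfies an Artin-Schreier equation, so M has a highest weight vector
    w ([highest_weight_vector]). The odd reflections lead from 1 (x) w to f_top (x) w through Borel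
    subalgebras with the same even part. At each step e_a f_a acts by the eigenvalue of h_a, which
    cannot vanish because h_a^p = h_a + chi(h_a)^p ([odd_reflection_coef], [odd_reflections]). Hence
    1 (x) w lies in N, and M being simple gives all of Z.

    The argument needs 1 (x) v to be nonzero, a fact of Poincare-Birkhoff-Witt type. It is obtained
    in [kac_tens1_neq0] by checking that explicit operators on alternating maps satisfy the
    relations of u(g, chi). The p-th power relation there rests on [iter_rad_pchar]. *)

(** * Iterated commutators in characteristic p *)

Section AdPower.
Variables (S : pzRingType) (x : S).

Definition rad (y : S) : S := y * x - x * y.

Lemma iter_radE k y : iter k rad y =
  \sum_(i < k.+1) (-1) ^+ i * (x ^+ i * y * x ^+ (k - i)) *+ 'C(k, i).
Proof.
elim: k => [|k IH]; first by rewrite big_ord1 !expr0 !mul1r mulr1 bin0.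
rewrite iterS IH /rad mulr_suml mulr_sumr.
rewrite [RHS]big_ord_recl [X in X - _]big_ord_recl !bin0 -addrA.
congr (_ + _); first by rewrite !expr0 !mul1r !subn0 !mulr1n -mulrA -exprSr.
under [in RHS]eq_bigr => i _ do rewrite /= /bump /= add1n binS mulrnDr subSS.
rewrite big_split -sumrN /=; congr (_ + _); last first.
  apply: eq_bigr => i _; rewrite mulrnAr -mulNrn. congr (_ *+ _).
  rewrite [in RHS]exprS mulN1r mulNr; congr (- _).
  by rewrite (mulrA x) (commr_sign x i) -mulrA exprS !mulrA.
rewrite [RHS]big_ord_recr /= bin_small // mulr0n addr0; apply: eq_bigr => i _.
by rewrite /bump /= add1n mulrnAl -!mulrA -exprSr subnSK.
Qed.

(** Right and left multiplication by x commute, so [iter_radE] is the binomial expansion of a power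
    of their difference. The inner binomial coefficients are divisible by p, and oddness of p gives
    the sign of the last term. *)
Lemma iter_rad_pchar p y : prime p -> odd p -> (forall z : S, z *+ p = 0) ->
  iter p rad y = y * x ^+ p - x ^+ p * y.
Proof.
move=> pp po p0; rewrite iter_radE big_ord_recl.
case: p pp po p0 => // p pp po p0; rewrite big_ord_recr /=.
rewrite big1 ?add0r; last first.
  move=> [i ip] _ /=; rewrite /bump /= add1n.
  have /dvdnP[c ->] : (p.+1 %| 'C(p.+1, i.+1))%N by rewrite prime_dvd_bin //=; lia.
  by rewrite mulrnA p0.
rewrite /bump /= add1n subnn bin0 binn !mulr1n !expr0 !mul1r subn0 mulr1.
by rewrite -signr_odd po expr1 mulN1r.
Qed.
End AdPower.


(** * The ring of linear endomorphisms of a module *)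

Section LEnd.
Variables (R : comPzRingType) (V : lmodType R).

(** Endomorphisms are functions rather than matrices, since V carries no finiteness. Linearity sits
    beside the function as a proposition, so equality is pointwise equality. *)
Record lend := LEnd { lend_fun :> V -> V; lend_linear : linear lend_fun }.

HB.instance Definition _ := gen_eqMixin lend.
HB.instance Definition _ := gen_choiceMixin lend.

Lemma lendP (f g : lend) : f =1 g -> f = g.
Proof.
case: f g => [f lf] [g lg] /= /funext fg; subst g.
by rewrite (Prop_irrelevance lf lg).
Qed.

Lemma lendD (f : lend) v w : f (v + w) = f v + f w.
Proof. by rewrite -[v]scale1r lend_linear !scale1r. Qed.
Lemma lend0 (f : lend) : f 0 = 0.
Proof. by apply: (addIr (f 0)); rewrite -lendD !add0r. Qed.
Lemma lendZ (f : lend) c v : f (c *: v) = c *: f v.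
Proof. by rewrite -[c *: v]addr0 lend_linear lend0 addr0. Qed.
Lemma lendN (f : lend) v : f (- v) = - f v.
Proof. by rewrite -scaleN1r lendZ scaleN1r. Qed.

Fact lend0_linear : linear (fun _ : V => 0 : V).
Proof. by move=> c v w; rewrite scaler0 addr0. Qed.
Fact lend1_linear : linear (fun v : V => v).
Proof. by []. Qed.
Fact lend_opp_linear (f : lend) : linear (fun v => - f v).
Proof. by move=> c v w; rewrite lend_linear opprD scalerN. Qed.
Fact lend_add_linear (f g : lend) : linear (fun v => f v + g v).
Proof. by move=> c v w; rewrite !lend_linear scalerDr addrACA. Qed.
Fact lend_mul_linear (f g : lend) : linear (fun v => f (g v)).
Proof. by move=> c v w; rewrite !lend_linear. Qed.
Fact lend_scal_linear (c : R) : linear (fun v : V => c *: v).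
Proof. by move=> d v w; rewrite scalerDr !scalerA mulrC. Qed.

Fact lend_addA : associative (fun f g => LEnd (lend_add_linear f g)).
Proof. by move=> f g h; apply: lendP => v /=; rewrite addrA. Qed.
Fact lend_addC : commutative (fun f g => LEnd (lend_add_linear f g)).
Proof. by move=> f g; apply: lendP => v /=; rewrite addrC. Qed.
Fact lend_add0 :
  left_id (LEnd lend0_linear) (fun f g => LEnd (lend_add_linear f g)).
Proof. by move=> f; apply: lendP => v /=; rewrite add0r. Qed.
Fact lend_addN : left_inverse (LEnd lend0_linear)
  (fun f => LEnd (lend_opp_linear f)) (fun f g => LEnd (lend_add_linear f g)).
Proof. by move=> f; apply: lendP => v /=; rewrite addNr. Qed.
HB.instance Definition _ :=
  GRing.isZmodule.Build lend lend_addA lend_addC lend_add0 lend_addN.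

Fact lend_mulA : associative (fun f g => LEnd (lend_mul_linear f g)).
Proof. by move=> f g h; apply: lendP. Qed.
Fact lend_mul1 :
  left_id (LEnd lend1_linear) (fun f g => LEnd (lend_mul_linear f g)).
Proof. by move=> f; apply: lendP. Qed.
Fact lend_mulr1 :
  right_id (LEnd lend1_linear) (fun f g => LEnd (lend_mul_linear f g)).
Proof. by move=> f; apply: lendP. Qed.
Fact lend_mulDl :
  left_distributive (fun f g => LEnd (lend_mul_linear f g)) +%R.
Proof. by move=> f g h; apply: lendP. Qed.
Fact lend_mulDr :
  right_distributive (fun f g => LEnd (lend_mul_linear f g)) +%R.
Proof. by move=> f g h; apply: lendP => v /=; rewrite lendD. Qed.
HB.instance Definition _ := GRing.Zmodule_isPzRing.Build lend
  lend_mulA lend_mul1 lend_mulr1 lend_mulDl lend_mulDr.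

Lemma lend_addE (f g : lend) v : (f + g) v = f v + g v. Proof. by []. Qed.
Lemma lend_oppE (f : lend) v : (- f) v = - f v. Proof. by []. Qed.
Lemma lend_zeroE v : (0 : lend) v = 0. Proof. by []. Qed.
Lemma lend_oneE v : (1 : lend) v = v. Proof. by []. Qed.
Lemma lend_mulE (f g : lend) v : (f * g) v = f (g v). Proof. by []. Qed.
Definition lendE :=
  (lend_addE, lend_oppE, lend_mulE, lend_zeroE, lend_oneE).

Definition lend_scal (c : R) : lend := LEnd (lend_scal_linear c).
Fact lend_scal_zmod : zmod_morphism lend_scal.
Proof. by move=> c d; apply: lendP => v; rewrite !lendE /= scalerBl. Qed.
Fact lend_scal_monoid : monoid_morphism lend_scal.
Proof.
split=> [|c d]; apply: lendP => v /=; first by rewrite scale1r.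
by rewrite scalerA.
Qed.
HB.instance Definition _ :=
  GRing.isZmodMorphism.Build R lend lend_scal lend_scal_zmod.
HB.instance Definition _ :=
  GRing.isMonoidMorphism.Build R lend lend_scal lend_scal_monoid.

Lemma lend_scalC c (f : lend) : lend_scal c * f = f * lend_scal c.
Proof. by apply: lendP => v; rewrite !lendE /= lendZ. Qed.

Fact lend_actA (f g : lend) v : f (g v) = (f * g) v. Proof. by []. Qed.
Fact lend_act1 : left_id (1 : lend) (fun (f : lend) v => f v). Proof. by []. Qed.
Fact lend_actDr : right_distributive (fun (f : lend) (v : V) => f v) +%R.
Proof. exact: lendD. Qed.
Fact lend_actDl v : {morph (fun f : lend => f v) : f g / f + g}.
Proof. by []. Qed.

(** An alias, because V already has an R-module structure and the action of its endomorphism ring is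
    a second one. *)
Definition lend_mod : Type := V.
HB.instance Definition _ := GRing.Zmodule.on lend_mod.
HB.instance Definition _ := GRing.Zmodule_isLmodule.Build lend lend_mod
  lend_actA lend_act1 lend_actDr lend_actDl.
End LEnd.

(** * Rearranging sums and commutators *)

Lemma eq_add0B (V : zmodType) (x y : V) : 0 + (x - y) = 0 -> x = y.
Proof. by rewrite add0r => /subr0_eq. Qed.
(* Proves identities in a [zmodType]: once both sides are in one flat sum,
   [zcancel v] moves [v] and [- v] to its end. It loops if [v] occurs twice. *)
Ltac zmove := apply: eq_add0B; rewrite !(opprD, opprK, addrA).
Ltac zcancel v := rewrite ?(addrAC _ (- v)) ?(addrAC _ v) addrNK.

(** The commutators of u with XY - YX and with Z agree by the Jacobi identity, whose content is the
    hypothesis on [uz]. *)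
Lemma comm_step (S : pzRingType) (u X Y Z ux uy uz uxy uyx : S) :
  u * X = X * u + ux -> u * Y = Y * u + uy -> u * Z = Z * u + uz ->
  ux * Y = Y * ux + uxy -> uy * X = X * uy + uyx -> uz = uxy - uyx ->
  u * (X * Y - Y * X - Z) = (X * Y - Y * X - Z) * u.
Proof.
move=> hX hY hZ hxY hyX huz.
have eXY : u * (X * Y) = X * Y * u + (X * uy + Y * ux + uxy).
  by rewrite mulrA hX mulrDl -mulrA hY mulrDr hxY !mulrA !addrA.
have eYX : u * (Y * X) = Y * X * u + (X * uy + Y * ux + uyx).
  rewrite mulrA hY mulrDl -mulrA hX mulrDr hyX addrACA !mulrA !addrA.
  by rewrite [_ + Y * ux + _]addrAC -!addrA.
rewrite !mulrBr eXY eYX hZ huz !mulrBl.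
move: (_ + Y * ux) (X * Y * u) (Y * X * u) (Z * u) => w a b z.
rewrite (opprD b) (addrACA a) (opprD w) (addrACA w) subrr add0r.
by rewrite (opprD z) (addrACA (a - b)) subrr addr0.
Qed.

(** * The p-fold adjoint action of a block diagonal matrix *)

Section BlockPower.
Variables (F : fieldType) (m n : nat).

Lemma block_diag_expr (A : 'M[F]_m) (D : 'M[F]_n) k :
  (block_mx A 0 0 D : 'M_(m + n)) ^+ k = block_mx (A ^+ k) 0 0 (D ^+ k).
Proof.
elim: k => [|k IH]; first by rewrite !expr0 -scalar_mx_block.
rewrite !exprS IH [LHS]mulmx_block.
by rewrite !mul0mx !mulmx0 !addr0 add0r.
Qed.

(** This is [iter_rad_pchar] inside gl(m + n), read off in the upper right block. *)
Lemma iter_ad_pchar p (A : 'M[F]_m) (D : 'M[F]_n) (b : 'M[F]_(m, n)) :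
  p \in [pchar F] -> odd p ->
  iter p (fun c => c *m D - A *m c) b = b *m D ^+ p - A ^+ p *m b.
Proof.
move=> pF po; pose up c : 'M[F]_(m + n) := block_mx 0 c 0 0.
have radE c : rad (block_mx A 0 0 D) (up c) = up (c *m D - A *m c).
  rewrite /rad ![_ * _](mulmx_block) !mul0mx !mulmx0 !addr0 !add0r.
  by rewrite opp_block_mx add_block_mx !oppr0 !addr0. 
have iterE k c : iter k (rad (block_mx A 0 0 D)) (up c) =
    up (iter k (fun c => c *m D - A *m c) c).
  by elim: k => [|k IH] //; rewrite !iterS IH radE.
have p0 (z : 'M[F]_(m + n)) : z *+ p = 0 by rewrite -scaler_nat pcharf0 // scale0r.
have := iter_rad_pchar (block_mx A 0 0 D) (up b) (pcharf_prime pF) po p0.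
rewrite iterE block_diag_expr.
rewrite ![_ * _](mulmx_block) !mul0mx !mulmx0 !addr0 !add0r.
by rewrite opp_block_mx add_block_mx => /eq_block_mx[].
Qed.
End BlockPower.

(** * The coinduced module and the relations between its operators *)

Section Coinduced.
Variables (F : fieldType) (m n : nat) (V : lmodType F).
Variable rho : 'M[F]_m -> 'M[F]_n -> lend V.
Local Notation B := 'M[F]_(m, n).
Local Notation Phi := (seq B -> V).

Hypothesis rho_linear : forall c A D A' D',
  rho (c *: A + A') (c *: D + D') = lend_scal V c * rho A D + rho A' D'.
Hypothesis rho_bracket : forall A D A' D',
  rho A D * rho A' D' - rho A' D' * rho A D
  = rho (A *m A' - A' *m A) (D *m D' - D' *m D).

(* The module coinduced from [gl_down + gl_even], with [gl_down] acting by 0 on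
   [V]: its elements are the alternating multilinear maps from words in [gl_up] to
   [V], where [b] in [gl_up] acts by [shift b], the block diagonal matrix (A, D) by
   [even_fun A D] and [C] in [gl_down] by [down_fun C]; the recursion moves the
   acting element to the left through the letters of the word. *)
Definition shift (b : B) (phi : Phi) : Phi := fun w => phi (b :: w).

Fixpoint even_fun A D (phi : Phi) (w : seq B) : V :=
  if w is b :: w' then
    even_fun A D (shift b phi) w' + phi ((b *m D - A *m b) :: w')
  else rho A D (phi [::]).

Fixpoint down_fun (C : 'M[F]_(n, m)) (phi : Phi) (w : seq B) : V :=
  if w is b :: w' then
    even_fun (b *m C) (C *m b) phi w' - down_fun C (shift b phi) w'
  else 0.

Definition multilinear (phi : Phi) := forall u c b b' w,
  phi (u ++ (c *: b + b') :: w) = c *: phi (u ++ b :: w) + phi (u ++ b' :: w).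
Definition alternate (phi : Phi) := forall u b b' w,
  phi (u ++ b :: b' :: w) = - phi (u ++ b' :: b :: w).

Lemma even_fun_linear A D : linear (even_fun A D).
Proof.
move=> c phi psi; apply: funext => w.
rewrite -[RHS]/(c *: even_fun A D phi w + even_fun A D psi w).
elim: w phi psi => [|b w IH] phi psi /=; first by rewrite lend_linear.
have -> : shift b (c *: phi + psi) = c *: shift b phi + shift b psi by [].
by rewrite IH scalerDr addrACA.
Qed.

Lemma down_fun_linear C : linear (down_fun C).
Proof.
move=> c phi psi; apply: funext => w.
rewrite -[RHS]/(c *: down_fun C phi w + down_fun C psi w).
elim: w phi psi => [|b w IH] phi psi /=; first by rewrite scaler0 addr0.
have -> : shift b (c *: phi + psi) = c *: shift b phi + shift b psi by [].
rewrite IH even_fun_linear scalerBr opprD.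
by rewrite -![(_ *: _ + _) w]/(_ *: _ w + _ w) addrACA.
Qed.

Lemma even_funZD A D c (phi psi : Phi) w :
  even_fun A D (c *: phi + psi) w = c *: even_fun A D phi w + even_fun A D psi w.
Proof. by rewrite even_fun_linear. Qed.

Lemma down_funZD C c (phi psi : Phi) w :
  down_fun C (c *: phi + psi) w = c *: down_fun C phi w + down_fun C psi w.
Proof. by rewrite down_fun_linear. Qed.

Lemma even_funN A D phi w : even_fun A D (- phi) w = - even_fun A D phi w.
Proof.
exact: (congr1 (@^~ w) (lendN (LEnd (even_fun_linear A D)) phi)).
Qed.

Lemma down_funN C phi w : down_fun C (- phi) w = - down_fun C phi w.
Proof.
exact: (congr1 (@^~ w) (lendN (LEnd (down_fun_linear C)) phi)).
Qed.

Lemma shift_multilinear b phi : multilinear phi -> multilinear (shift b phi).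
Proof. by move=> h u; apply: (h (b :: u)). Qed.
Lemma shift_alternate b phi : alternate phi -> alternate (shift b phi).
Proof. by move=> h u; apply: (h (b :: u)). Qed.

Lemma shift_linear phi c b b' : multilinear phi ->
  shift (c *: b + b') phi = c *: shift b phi + shift b' phi.
Proof. by move=> h; apply: funext => w; apply: (h [::]). Qed.

Lemma multilinearN phi b w : multilinear phi ->
  phi (- b :: w) = - phi (b :: w).
Proof.
move=> h; have h0 : phi (0 :: w) = 0.
  apply: (addIr (phi (0 :: w))); rewrite add0r.
  by have := h [::] 1 0 0 w; rewrite !scale1r addr0 /= => <-.
by have := h [::] (-1) b 0 w; rewrite /= h0 !addr0 !scaleN1r.
Qed.

Lemma shift_shift phi b b' : alternate phi ->
  shift b (shift b' phi) = - shift b' (shift b phi).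
Proof. by move=> h; apply: funext => w; apply: (h [::]). Qed.

Lemma ad_linear (A : 'M[F]_m) (D : 'M[F]_n) c (b b' : B) :
  (c *: b + b') *m D - A *m (c *: b + b')
  = c *: (b *m D - A *m b) + (b' *m D - A *m b').
Proof.
by rewrite mulmxDl mulmxDr -scalemxAl -scalemxAr scalerBr opprD addrACA.
Qed.

Lemma even_multilinear A D phi : multilinear phi -> multilinear (even_fun A D phi).
Proof.
move=> h u; elim: u phi h => [|a u IH] phi h c b b' w /=.
  rewrite shift_linear // even_funZD ad_linear.
  by rewrite (h [::]) scalerDr addrACA.
rewrite IH; last exact: shift_multilinear.
by rewrite (h (_ :: u)) scalerDr addrACA.
Qed.

Lemma even_alternate A D phi : alternate phi -> alternate (even_fun A D phi).
Proof.
move=> h u; elim: u phi h => [|a u IH] phi h b b' w /=.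
  rewrite shift_shift // even_funN !opprD -!addrA; congr (_ + _).
  rewrite -[shift b phi (_ :: w)]/(phi _) -[shift b' phi (_ :: w)]/(phi _).
  have h0 c d : phi [:: c, d & w] = - phi [:: d, c & w] := h [::] c d w.
  by rewrite (h0 b) (h0 _ b') addrC.
by rewrite IH ?(h (_ :: u) b b' w) ?opprD //; apply: shift_alternate.
Qed.

Lemma down_multilinear C phi : multilinear phi -> multilinear (down_fun C phi).
Proof.
move=> h u; elim: u phi h => [|a u IH] phi h c b b' w /=.
  (* The letter that meets C enters through the acting matrices, so the point is linearity of
     [even_fun] in its matrices, which comes from [rho_linear]. *)
  have h1 : even_fun ((c *: b + b') *m C) (C *m (c *: b + b')) phi w =
      c *: even_fun (b *m C) (C *m b) phi w + even_fun (b' *m C) (C *m b') phi w.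
    rewrite mulmxDl mulmxDr -scalemxAl -scalemxAr.
    elim: w phi h => [|d w IH] phi h /=; first by rewrite rho_linear.
    rewrite IH ?scalerDr; last exact: shift_multilinear.
    rewrite addrACA -(h [::]) /=; congr (_ + phi (_ :: w)).
    rewrite mulmxDl mulmxDr -!scalemxAl -!scalemxAr.
    by rewrite scalerBr opprD addrACA.
  by rewrite h1 shift_linear // down_funZD scalerBr opprD addrACA.
rewrite even_multilinear // IH; last exact: shift_multilinear.
by rewrite scalerBr opprD addrACA.
Qed.

Lemma down_alternate C phi : multilinear phi -> alternate phi ->
  alternate (down_fun C phi).
Proof.
move=> hm h u; elim: u phi hm h => [|a u IH] phi hm h b b' w /=.
  (* The letter created by C passing both b and b' changes sign when b and b' are exchanged. *)
  have bC : b *m (C *m b') - b' *m C *m b = - (b' *m (C *m b) - b *m C *m b').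
    by rewrite opprB !mulmxA.
  rewrite bC (shift_shift _ _ h) down_funN multilinearN // opprK !opprB.
  by rewrite opprD [X in _ + X = _]addrC addrACA.
by rewrite even_alternate // IH ?opprK 1?opprB 1?addrC //;
  [exact: shift_multilinear | exact: shift_alternate].
Qed.

Definition coind_pred : {pred Phi} :=
  fun phi => `[< multilinear phi /\ alternate phi >].

Fact coind_closed : submod_closed coind_pred.
Proof.
split=> [|c phi psi /asboolP[m1 a1] /asboolP[m2 a2]]; apply/asboolP; split.
- by move=> u d b b' w; rewrite -![0 _]/(0 : V) scaler0 addr0.
- by move=> u b b' w; rewrite -![0 _]/(0 : V) oppr0.
- move=> u d b b' w; rewrite -![(_ *: _ + _) _]/(_ *: _ _ + _ _) m1 m2.
  by rewrite !scalerDr !scalerA [d * c]mulrC addrACA.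
- move=> u b b' w; rewrite -![(_ *: _ + _) _]/(_ *: _ _ + _ _).
  by rewrite a1 a2 scalerN opprD.
Qed.
HB.instance Definition _ := GRing.isSubmodClosed.Build F Phi coind_pred coind_closed.

Record coind := Coind { coind_val :> Phi; _ : coind_val \in coind_pred }.
HB.instance Definition _ := [isSub for coind_val].
HB.instance Definition _ := [Choice of coind by <:].
HB.instance Definition _ := [SubChoice_isSubLmodule of coind by <:].

Lemma coindP (phi : coind) : multilinear phi /\ alternate phi.
Proof. by case: phi => phi /= /asboolP. Qed.

Lemma coind_eq (phi psi : coind) : phi =1 psi -> phi = psi.
Proof. by move=> /funext e; apply: val_inj. Qed.

Definition coind_of phi (h : multilinear phi /\ alternate phi) : coind :=
  Coind (asboolT h).

Fact up_subproof b (phi : coind) :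
  multilinear (shift b phi) /\ alternate (shift b phi).
Proof.
by case: (coindP phi); split; [exact: shift_multilinear | exact: shift_alternate].
Qed.
Fact even_subproof A D (phi : coind) :
  multilinear (even_fun A D phi) /\ alternate (even_fun A D phi).
Proof.
by case: (coindP phi); split; [exact: even_multilinear | exact: even_alternate].
Qed.
Fact down_subproof C (phi : coind) :
  multilinear (down_fun C phi) /\ alternate (down_fun C phi).
Proof.
by case: (coindP phi); split; [exact: down_multilinear | exact: down_alternate].
Qed.

Fact up_linear_subproof b : linear (fun phi => coind_of (up_subproof b phi)).
Proof. by move=> c phi psi; apply: val_inj. Qed.
Fact even_linear_subproof A D :
  linear (fun phi => coind_of (even_subproof A D phi)).
Proof. by move=> c phi psi; apply: val_inj; apply: even_fun_linear. Qed.
Fact down_linear_subproof C : linear (fun phi => coind_of (down_subproof C phi)).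
Proof. by move=> c phi psi; apply: val_inj; apply: down_fun_linear. Qed.

Definition up_op b : lend coind := LEnd (up_linear_subproof b).
Definition even_op A D : lend coind := LEnd (even_linear_subproof A D).
Definition down_op C : lend coind := LEnd (down_linear_subproof C).

(* Relations between the operators only have to be checked up to commuting with
   the letters. *)
Lemma lend_coind_eq0 (T : lend coind) :
  (forall phi, T phi [::] = 0) ->
  (forall b, up_op b * T = T * up_op b \/ up_op b * T = - (T * up_op b)) -> T = 0.
Proof.
move=> T0 Tup; apply: lendP => phi; apply: coind_eq => w.
rewrite -[RHS]/(0 : V); elim: w phi => [|b w IH] phi; first exact: T0.
rewrite -[LHS]/((up_op b * T) phi w); case: (Tup b) => ->; first exact: IH.
by rewrite -[LHS]/(- ((T (up_op b phi)) w)) IH oppr0.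
Qed.

Lemma up_op_linear c b b' : up_op (c *: b + b') = lend_scal _ c * up_op b + up_op b'.
Proof.
apply: lendP => phi; apply: val_inj; apply: shift_linear.
by case: (coindP phi).
Qed.

Lemma up_even_op b A D :
  up_op b * even_op A D = even_op A D * up_op b + up_op (b *m D - A *m b).
Proof. by apply: lendP => phi; apply: coind_eq. Qed.

Lemma up_down_op b C :
  up_op b * down_op C = even_op (b *m C) (C *m b) - down_op C * up_op b.
Proof. by apply: lendP => phi; apply: coind_eq. Qed.

Lemma up_up_op b b' : up_op b * up_op b' = - (up_op b' * up_op b).
Proof.
apply: lendP => phi; apply: val_inj; apply: shift_shift.
by case: (coindP phi).
Qed.

Lemma up_opB b b' : up_op (b - b') = up_op b - up_op b'.
Proof.
by rewrite addrC -scaleN1r up_op_linear rmorphN1 mulN1r addrC.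
Qed.

Lemma even_op_linear c A D A' D' : even_op (c *: A + A') (c *: D + D')
  = lend_scal _ c * even_op A D + even_op A' D'.
Proof.
apply/subr0_eq/lend_coind_eq0 => [phi|b].
  rewrite -[LHS]/(rho _ _ _ - (c *: rho _ _ _ + rho _ _ _)).
  by rewrite rho_linear subrr.
left; rewrite mulrBr mulrDr mulrA -lend_scalC -mulrA !up_even_op.
rewrite mulrBl mulrDl mulrDr mulrA.
have -> : b *m (c *: D + D') - (c *: A + A') *m b =
   c *: (b *m D - A *m b) + (b *m D' - A' *m b).
  by rewrite mulmxDl mulmxDr -scalemxAl -scalemxAr scalerBr opprD addrACA.
by rewrite up_op_linear [X in _ - X]addrACA opprD [LHS]addrACA subrr addr0.
Qed.

Lemma down_op_linear c C C' :
  down_op (c *: C + C') = lend_scal _ c * down_op C + down_op C'.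
Proof.
apply/subr0_eq/lend_coind_eq0 => [phi|b].
  by rewrite -[LHS]/(0 - (c *: 0 + 0) : V) scaler0 addr0 subrr.
right; rewrite mulrBr mulrDr mulrA -lend_scalC -mulrA !up_down_op.
rewrite mulmxDl mulmxDr -scalemxAl -scalemxAr even_op_linear.
rewrite [in RHS]mulrBl mulrDl mulrBr -!mulrA opprB.
move: (lend_scal _ c * even_op _ _) (even_op (b *m C') _)
  (lend_scal _ c * (_ * _)) (down_op (_ + _) * _) (down_op C' * _) => P Q x d y.
rewrite (addrACA P) -(opprD x y) (opprD (P + Q)) opprK (addrACA (P + Q)).
by rewrite subrr add0r addrC.
Qed.

Lemma even_even_op A D A' D' :
  even_op A D * even_op A' D' - even_op A' D' * even_op A D
  = even_op (A *m A' - A' *m A) (D *m D' - D' *m D).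
Proof.
apply/subr0_eq/lend_coind_eq0 => [phi|b].
  rewrite -[LHS]/((rho A D * rho A' D' - rho A' D' * rho A D
    - rho (A *m A' - A' *m A) (D *m D' - D' *m D)) (phi [::])).
  by rewrite rho_bracket subrr.
left; apply: comm_step (up_even_op _ _ _) (up_even_op _ _ _) (up_even_op _ _ _)
  (up_even_op _ _ _) (up_even_op _ _ _) _.
rewrite -up_opB; congr up_op.
rewrite !(mulmxBl, mulmxBr) !mulmxA.
move: (b *m D *m D') (A *m b *m D') (A' *m b *m D) (A' *m A *m b)
  (b *m D' *m D) (A *m A' *m b) => p1 p2 p3 p4 p5 p6.
by apply/matrixP => i j; rewrite !mxE; ring.
Qed.

(** The difference of the two sides anticommutes with every letter: the correction terms cancel by
    the Jacobi identity for b, (A, D) and C. *)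
Lemma even_down_op A D C :
  even_op A D * down_op C - down_op C * even_op A D = down_op (D *m C - C *m A).
Proof.
apply/subr0_eq/lend_coind_eq0 => [phi|b].
  by rewrite -[LHS]/(rho A D 0 - 0 - 0) !subr0 lend0.
right; have hX := up_even_op b A D; have hY := up_down_op b C.
have hxY := up_down_op (b *m D - A *m b) C.
set X := even_op A D in hX *; set Y := down_op C in hY hxY *.
have eXY : up_op b * (X * Y) = - (X * Y * up_op b) + (X * even_op (b *m C) (C *m b)
    + (even_op ((b *m D - A *m b) *m C) (C *m (b *m D - A *m b))
    - Y * up_op (b *m D - A *m b))).
  rewrite mulrA hX mulrDl -(mulrA X) hY mulrBr hxY mulrA [X * _ - _]addrC.
  by rewrite -addrA.
have eYX : up_op b * (Y * X) = - (Y * X * up_op b) + (even_op (b *m C) (C *m b) * X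
    - Y * up_op (b *m D - A *m b)).
  rewrite mulrA hY mulrBl -(mulrA Y (up_op b)) hX mulrDr mulrA opprD addrA.
  by rewrite [RHS]addrA [- _ + _ * X]addrC.
have eZ : even_op (b *m (D *m C - C *m A)) ((D *m C - C *m A) *m b) =
    even_op ((b *m D - A *m b) *m C) (C *m (b *m D - A *m b)) +
    (X * even_op (b *m C) (C *m b) - even_op (b *m C) (C *m b) * X).
  rewrite even_even_op -[X in _ = X + _]mul1r -(rmorph1 (lend_scal _)).
  rewrite -even_op_linear !scale1r; congr even_op;
  rewrite !(mulmxBl, mulmxBr) !mulmxA.
    move: (b *m D *m C) (b *m C *m A) (A *m b *m C) => p1 p2 p3.
    by apply/matrixP => i j; rewrite !mxE; ring.
  move: (D *m C *m b) (C *m b *m D) (C *m A *m b) => p1 p2 p3.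
  by apply/matrixP => i j; rewrite !mxE; ring.
rewrite !mulrBr eXY eYX up_down_op eZ !mulrBl.
move: (even_op (b *m C) _) (X * Y * _) (Y * X * _) (down_op (_ - _) * _)
  (Y * up_op (_ - _)) (even_op ((_ - _) *m C) _) => e a1 a2 a3 a4 a5.
move: (e * X) (X * e) => a6 a7.
by zmove; zcancel a1; zcancel a2; zcancel a3; zcancel a4; zcancel a5; zcancel a6;
  zcancel a7.
Qed.

Lemma down_down_op C C' : down_op C * down_op C' + down_op C' * down_op C = 0.
Proof.
rewrite -[LHS]subr0; apply/subr0_eq/lend_coind_eq0 => [phi|b].
  by rewrite -[LHS]/(0 + 0 - 0 - 0 : V) !subr0 addr0.
left; rewrite !subr0 mulrDr mulrDl !mulrA !up_down_op !mulrBl -!mulrA !up_down_op.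
rewrite !mulrBr.
(* Both commutators are [down_op] of C b C' - C' b C up to sign, which is antisymmetric in C and
   C'. *)
have h : even_op (b *m C) (C *m b) * down_op C'
    - down_op C' * even_op (b *m C) (C *m b)
  = - (even_op (b *m C') (C' *m b) * down_op C
    - down_op C * even_op (b *m C') (C' *m b)).
  rewrite !even_down_op; apply/eqP; rewrite -addr_eq0.
  rewrite -[X in X + _]mul1r -(rmorph1 (lend_scal _)) -down_op_linear scale1r.
  rewrite addrC addrA !mulmxA subrK subrr -(subrr C) -scaleN1r addrC.
  by rewrite down_op_linear rmorphN1 mulN1r addNr.
move/eqP: h; rewrite -subr_eq0 opprK => /eqP h.
apply/eqP; rewrite -subr_eq0 -[X in _ == X]h; apply/eqP.
move: (even_op (b *m C) _ * _) (down_op C' * even_op _ _)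
  (even_op (b *m C') _ * _) (down_op C * even_op _ _)
  (down_op C * (down_op C' * _)) (down_op C' * (down_op C * _))
  => a1 a2 a3 a4 a5 a6.
by zmove; zcancel a1; zcancel a2; zcancel a3; zcancel a4; zcancel a5; zcancel a6.
Qed.

(** On the empty word this is the relation for [rho]. The p-th power moves past a letter b with
    correction b D^p - A^p b, by the p-fold adjoint action, and this is also the correction for the
    block diagonal matrix (A^p, D^p). *)
Lemma even_op_pow p A D c : p \in [pchar F] -> odd p ->
  rho A D ^+ p = rho (A ^+ p) (D ^+ p) + lend_scal V c ->
  even_op A D ^+ p = even_op (A ^+ p) (D ^+ p) + lend_scal _ c.
Proof.
move=> pF po rhop; apply/subr0_eq/lend_coind_eq0 => [phi|b].
  have powE k : (even_op A D ^+ k) phi [::] = (rho A D ^+ k) (phi [::]).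
    elim: k => [|k IH] //; rewrite !exprS.
    by rewrite -[RHS]/(rho A D ((rho A D ^+ k) (phi [::]))) -IH.
  rewrite -[LHS]/((even_op A D ^+ p) phi [::] -
    (rho (A ^+ p) (D ^+ p) (phi [::]) + c *: phi [::])).
  by rewrite powE rhop subrr.
left; have p0 (z : lend coind) : z *+ p = 0.
  apply: lendP => phi; have -> k : (z *+ k) phi = z phi *+ k.
    by elim: k => [|k IH]; rewrite ?mulr0n // !mulrS -IH.
  by rewrite -scaler_nat pcharf0 // scale0r.
have iterE k : iter k (rad (even_op A D)) (up_op b) =
    up_op (iter k (fun c => c *m D - A *m c) b).
  by elim: k => [|k IH] //; rewrite !iterS IH /rad up_even_op addrAC subrr add0r.
have := iter_rad_pchar (even_op A D) (up_op b) (pcharf_prime pF) po p0.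
rewrite iterE iter_ad_pchar // => h.
have -> : up_op b *
    (even_op A D ^+ p - (even_op (A ^+ p) (D ^+ p) + lend_scal coind c)) =
  up_op b * even_op A D ^+ p -
    (up_op b * even_op (A ^+ p) (D ^+ p) + lend_scal coind c * up_op b).
  by rewrite mulrBr mulrDr lend_scalC.
rewrite up_even_op h mulrBl mulrDl.
move: (up_op b * _) (_ ^+ p * _) (_ * up_op b) (_ * up_op b) => a1 a2 a3 a4.
by zmove; zcancel a1; zcancel a2; zcancel a3; zcancel a4.
Qed.

End Coinduced.

(** * Generators of the reduced enveloping algebras *)

Lemma free_alg_ind (F : fieldType) (X : choiceType) (P : free_alg F X -> Prop) :
  (forall c, P (free_scal F X c)) -> (forall x, P (letter F x)) ->
  (forall u v, P u -> P v -> P (u + v)) ->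
  (forall u v, P u -> P v -> P (u * v)) -> forall u, P u.
Proof.
move=> Pc Px PD PM.
have mulU (c d : F) (v w : {fmonom X}) :
    (<< c *g v >> * << d *g w >> : {malg F[{fmonom X}]}) = << c * d *g mmul v w >>.
  by rewrite (malgMEw msuppU_le msuppU_le) !big_seq_fset1 !mcoeffUU.
have P1 : P 1 by rewrite -(rmorph1 (free_scal F X)).
have P0 : P 0 by rewrite -(rmorph0 (free_scal F X)).
have Pw s : P (<< (1 : F) *g fmonom_of_seq fmonom_key s >> : {malg F[{fmonom X}]}).
  elim: s => [|x s IH]; first exact: (Pc 1).
  have -> : fmonom_of_seq fmonom_key (x :: s) =
      mmul (fmu x) (fmonom_of_seq fmonom_key s).
    by apply/val_inj; rewrite /= fmM fmU !fmE.
  by rewrite -[1]mulr1 -mulU; have := PM _ _ (Px x) IH; rewrite letter.unlock.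
move=> u; rewrite (monalgE (u : {malg F[{fmonom X}]})).
elim/big_ind: _ => // w _.
have -> : w = mmul (mone : {fmonom X}) (fmonom_of_seq fmonom_key (w : seq X)).
  by apply/val_inj; rewrite /= mul1m !fmE.
by rewrite -[mcoeff _ _]mulr1 -mulU; apply: PM; [exact: Pc | exact: Pw].
Qed.

Section RedenvInd.
Variables (F : fieldType) (m n p : nat) (L : {vspace 'M[F]_(m + n)}).
Variable chi : {scalar subvs_of (gl_even F m n)}.

Lemma redenv_ind (P : redenv L p chi -> Prop) :
  (forall c, P (red_scal L p chi c)) -> (forall x, P (red_gen p chi x)) ->
  (forall u v, P u -> P v -> P (u + v)) ->
  (forall u v, P u -> P v -> P (u * v)) -> forall u, P u.
Proof.
move=> Pc Px PD PM u; rewrite -(rreprK u) -(rreprK (rrepr u)).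
elim/free_alg_ind: (rrepr (rrepr u)) => [c|x|v w Pv Pw|v w Pv Pw].
- exact: Pc.
- exact: Px.
- by rewrite !rmorphD; apply: PD.
- by rewrite !rmorphM; apply: PM.
Qed.

Lemma redenv_submod (V : lmodType (redenv L p chi)) (N : V -> Prop) :
  (forall v w, N v -> N w -> N (v + w)) ->
  (forall c v, N v -> N (red_scal L p chi c *: v)) ->
  (forall x v, N v -> N (red_gen p chi x *: v)) -> forall u v, N v -> N (u *: v).
Proof.
move=> ND Nc Nx; elim/redenv_ind => [c|x|u u' IH IH'|u u' IH IH'] v Nv.
- exact: Nc.
- exact: Nx.
- by rewrite scalerDl; apply: ND; [apply: IH | apply: IH'].
- by rewrite -scalerA; apply/IH/IH'.
Qed.
End RedenvInd.

Section Generators.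
Variables (F : fieldType) (m n p : nat) (chi : {scalar subvs_of (gl_even F m n)}).
Local Notation g := 'M[F]_(m + n).

(** Projecting to L makes this total and linear on all matrices; only the bracket and p-th power
    relations then ask for membership in L. *)
Definition gen (L : {vspace g}) (x : g) : redenv L p chi := red_gen p chi (vsproj L x).

Variable L : {vspace g}.
Local Notation G := (gen L).
Local Notation sc := (red_scal L p chi).

Lemma red_genE (x : subvs_of L) : red_gen p chi x = G (vsval x).
Proof. by rewrite /gen vsvalK. Qed.

Lemma gen_linear c x y : G (c *: x + y) = sc c * G x + G y.
Proof. by rewrite /gen linearP red_gen_linear. Qed.

Lemma genD x y : G (x + y) = G x + G y.
Proof. by rewrite -[x]scale1r gen_linear rmorph1 mul1r scale1r. Qed.
Lemma gen0 : G 0 = 0.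
Proof. by apply: (addIr (G 0)); rewrite -genD !add0r. Qed.
Lemma genZ c x : G (c *: x) = sc c * G x.
Proof. by rewrite -[c *: x]addr0 gen_linear gen0 addr0. Qed.
Lemma genN x : G (- x) = - G x.
Proof. by rewrite -scaleN1r genZ rmorphN1 mulN1r. Qed.
Lemma genB x y : G (x - y) = G x - G y.
Proof. by rewrite genD genN. Qed.
Lemma gen_sum (I : Type) (r : seq I) (P : pred I) (E : I -> g) :
  G (\sum_(i <- r | P i) E i) = \sum_(i <- r | P i) G (E i).
Proof. exact: (big_morph G genD gen0). Qed.

Lemma gen_bracket a b x y : x \in L -> y \in L -> sbracket a b x y \in L ->
  x \in gl_par F m n a -> y \in gl_par F m n b ->
  G x * G y - (-1) ^+ (a && b) * (G y * G x) = G (sbracket a b x y).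
Proof. by move=> xL yL zL xa yb; apply: red_gen_bracket; rewrite !vsprojK. Qed.

Lemma gen_pow x : x \in gl_even F m n -> x \in L -> x ^+ p \in L ->
  G x ^+ p = G (x ^+ p) + sc (chi (vsproj (gl_even F m n) x) ^+ p).
Proof. by move=> xe xL xpL; apply: red_gen_pow; rewrite !vsprojK. Qed.

Definition unit_odd (i j : 'I_(m + n)) := (i < m)%N != (j < m)%N.

Lemma delta_gl_par i j : delta_mx i j \in gl_par F m n (unit_odd i j).
Proof.
rewrite /unit_odd /gl_par; case: ifP => [ij|/negbFE]; last exact: delta_gl_even.
have [im|mi] := ltnP i m.
  apply: (subvP (addvSl _ _)); apply/mem_unit_span => k l /=; rewrite mxE.
  case: (eqVneq k i) => [->|//]; case: (eqVneq l j) => [->|//].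
  by rewrite im leqNgt; move: ij; rewrite im; case: (j < m)%N.
apply: (subvP (addvSr _ _)); apply/mem_unit_span => k l /=; rewrite mxE.
case: (eqVneq k i) => [->|//]; case: (eqVneq l j) => [->|//].
by rewrite mi; move: ij; rewrite ltnNge mi; case: (j < m)%N.
Qed.

Lemma sbracket_delta a b i j k l :
  sbracket a b (delta_mx i j) (delta_mx k l) =
  delta_mx i l *+ (j == k) - (-1) ^+ (a && b) *: delta_mx k j *+ (l == i) :> g.
Proof. by rewrite /sbracket !mul_delta_mx_cond scalerMnr. Qed.

End Generators.

(** * Action of the generators on 1 (x) M *)

Section KacGenerators.
Variables (F : fieldType) (m n p : nat) (chi : {scalar subvs_of (gl_even F m n)}).
Local Notation g := 'M[F]_(m + n).
Local Notation G := (gen p chi {:g}%VS).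
Local Notation Ge := (gen p chi (gl_even F m n)).
Local Notation sc := (red_scal {:g}%VS p chi).

Lemma gen_delta i j k l :
  G (delta_mx i j) * G (delta_mx k l)
  - (-1) ^+ (unit_odd i j && unit_odd k l) * (G (delta_mx k l) * G (delta_mx i j))
  = G (delta_mx i l) *+ (j == k)
    - (-1) ^+ (unit_odd i j && unit_odd k l) * G (delta_mx k j) *+ (l == i).
Proof.
rewrite gen_bracket ?memvf ?delta_gl_par // sbracket_delta genB.
by congr (_ - _); case: eqP => _; rewrite ?mulr0n ?gen0 ?mulr1n // genZ rmorph_sign.
Qed.

Variable M : lmodType (redenv (gl_even F m n) p chi).
Local Notation Z := (kac_module M).
Local Notation f := (redenv_incl p chi (subvf (gl_plus F m n))).
Definition kac_tens (a : redenv {:g}%VS p chi) (v : M) : Z :=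
  @tens _ _ f (inflate M) a v.

Lemma kac_ind (P : Z -> Prop) : (forall z z', P z -> P z' -> P (z + z')) ->
  (forall a v, P (kac_tens a v)) -> forall z, P z.
Proof.
move=> PD Pt z; rewrite -(zreprK z) (monalgE (zrepr z)) raddf_sum.
have P0 : P 0.
  have := Pt 0 0; congr P; apply: (addIr (kac_tens 0 0)).
  by rewrite /kac_tens -tensDl !add0r.
by elim/big_ind: _ => // v _; apply: Pt.
Qed.

Lemma gl_even_plus x : x \in gl_even F m n -> x \in gl_plus F m n.
Proof. exact: (subvP (addvSl _ _)). Qed.
Lemma gl_up_plus x : x \in gl_up F m n -> x \in gl_plus F m n.
Proof. exact: (subvP (addvSr _ _)). Qed.

Lemma incl_gen x : x \in gl_plus F m n -> f (gen p chi (gl_plus F m n) x) = G x.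
Proof.
by move=> xp; rewrite red_lift_gen /gen; congr red_gen; rewrite /incl vsprojK.
Qed.

Lemma kac_tens_plus x v : x \in gl_plus F m n ->
  G x *: kac_tens 1 v = kac_tens 1 (Ge (even_part x) *: v).
Proof.
move=> xp; rewrite /kac_tens tensZ mulr1 -[G x]mul1r -incl_gen // tensM.
congr tens; rewrite -[LHS]/(redenv_even p chi (gen p chi _ x) *: (v : M)).
by rewrite red_lift_gen /gen /even_proj vsprojK.
Qed.

Lemma kac_tens_even x v : x \in gl_even F m n ->
  G x *: kac_tens 1 v = kac_tens 1 (Ge x *: v).
Proof.
by move=> xe; rewrite kac_tens_plus ?gl_even_plus // even_part_id.
Qed.

Lemma kac_tens_up x v : x \in gl_up F m n -> G x *: kac_tens 1 v = 0.
Proof.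
move=> xu; rewrite kac_tens_plus ?gl_up_plus // even_part_odd; last first.
  exact: (subvP (addvSl _ _)).
rewrite gen0 scale0r; apply: (addIr (kac_tens 1 0)).
by rewrite /kac_tens -tensDr !add0r.
Qed.

Lemma kac_tens_scal c v :
  sc c *: kac_tens 1 v = kac_tens 1 (red_scal (gl_even F m n) p chi c *: v).
Proof.
rewrite /kac_tens tensZ mulr1 -[sc c]mul1r.
have -> : sc c = f (red_scal _ p chi c) by rewrite red_lift_scal.
rewrite tensM; congr tens.
rewrite -[LHS]/(redenv_even p chi (red_scal _ p chi c) *: (v : M)).
by rewrite red_lift_scal.
Qed.

End KacGenerators.

(** * Semilinear maps and evaluation of tensors *)

Lemma redenv_semilinear (F : fieldType) (m n p : nat) (L : {vspace 'M[F]_(m + n)})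
    (chi : {scalar subvs_of (gl_even F m n)}) (A : pzRingType)
    (f : {rmorphism redenv L p chi -> A}) (M : lmodType (redenv L p chi))
    (W : lmodType A) (phi : M -> W) :
  {morph phi : v w / v + w} ->
  (forall c v, phi (red_scal L p chi c *: v) = f (red_scal L p chi c) *: phi v) ->
  (forall x v, phi (red_gen p chi x *: v) = f (red_gen p chi x) *: phi v) ->
  forall b v, phi (b *: v) = f b *: phi v.
Proof.
move=> phiD hc hx; elim/redenv_ind => // b c hb hc' v.
  by rewrite scalerDl phiD hb hc' rmorphD scalerDl.
by rewrite -scalerA hb hc' rmorphM scalerA.
Qed.

Section TensorLift.
Variables (B A : pzRingType) (f : {rmorphism B -> A}) (M : lmodType B).
Variables (W : lmodType A) (phi : M -> W).
Hypothesis phiD : {morph phi : v w / v + w}.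
Hypothesis phiZ : forall b v, phi (b *: v) = f b *: phi v.

Definition tensor_eval (g : {malg A[M]}) : W :=
  \sum_(v <- msupp g) g@_v *: phi v.

Lemma tensor_evalEw (d : {fset M}) g : (msupp g `<=` d)%fset ->
  tensor_eval g = \sum_(v <- d) g@_v *: phi v.
Proof.
move=> le; rewrite [LHS](big_fset_incl _ le) => //= v vd /mcoeff_outdom ->.
by rewrite scale0r.
Qed.

Lemma tensor_evalU a v : tensor_eval << a *g v >> = a *: phi v.
Proof. by rewrite (tensor_evalEw msuppU_le) big_seq_fset1 mcoeffUU. Qed.

Lemma tensor_evalB g1 g2 : tensor_eval (g1 - g2) = tensor_eval g1 - tensor_eval g2.
Proof.
pose d := (msupp g1 `|` msupp g2)%fset.
rewrite (@tensor_evalEw d) ?msuppB_le // (@tensor_evalEw d g1) ?fsubsetUl //.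
rewrite (@tensor_evalEw d g2) ?fsubsetUr // -sumrB; apply: eq_bigr => w _.
by rewrite mcoeffB scalerBl.
Qed.

(** Evaluation through a semilinear [phi] respects the tensor relations, so it can detect that a
    tensor is nonzero. *)
Lemma tens_eq0 a v : tens f a v = 0 -> a *: phi v = 0.
Proof.
move/zproj_ker; rewrite -tensor_evalU.
elim=> [|_ [b w w'|b c w]|x y _ hx _ hy].
- by rewrite -[X in tensor_eval X](subrr 0) tensor_evalB subrr.
- have ev0 : tensor_eval 0 = 0.
    by rewrite -[X in tensor_eval X](subrr 0) tensor_evalB subrr.
  have evN x : tensor_eval (- x) = - tensor_eval x.
    by rewrite -sub0r tensor_evalB ev0 sub0r.
  rewrite tensor_evalB -[X in _ - tensor_eval (_ + X)]opprK tensor_evalB evN opprK.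
  by rewrite !tensor_evalU phiD scalerDr subrr.
- by rewrite tensor_evalB !tensor_evalU phiZ scalerA subrr.
- by rewrite tensor_evalB hx hy subrr.
Qed.
End TensorLift.

(** * Nonvanishing of 1 (x) v *)

Section KacNonzero.
Variables (F : fieldType) (m n p : nat) (chi : {scalar subvs_of (gl_even F m n)}).
Hypotheses (pF : p \in [pchar F]) (po : odd p).
Variable M : lmodType (redenv (gl_even F m n) p chi).
Local Notation g := 'M[F]_(m + n).
Local Notation Ge := (gen p chi (gl_even F m n)).
Local Notation sce := (red_scal (gl_even F m n) p chi).
Local Notation MF := (restrict sce M : lmodType F).
Local Notation diag A D := (block_mx A 0 0 D : g).

Lemma diag_gl_even (A : 'M[F]_m) (D : 'M[F]_n) : diag A D \in gl_even F m n.
Proof.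
apply/mem_unit_span => i j; case: (split_ordP i) => i' ->; case: (split_ordP j) => j' ->;
rewrite /= ?ltn_ord ?[(m + _ < m)%N]ltnNge ?leq_addr //= => _.
  by rewrite block_mxEur mxE.
by rewrite block_mxEdl mxE.
Qed.

Lemma gl_even_diag (x : g) : x \in gl_even F m n -> x = diag (ulsubmx x) (drsubmx x).
Proof.
move/mem_unit_span => x0; rewrite -[LHS]submxK; congr block_mx; apply/matrixP => i j;
by rewrite !mxE x0 //= ltn_ord ltnNge leq_addr.
Qed.

Fact act_linear_subproof A D : linear (fun v : MF => (Ge (diag A D) *: (v : M) : MF)).
Proof.
move=> c v w; rewrite -[LHS]/(Ge _ *: (sce c *: (v : M) + w)).
by rewrite scalerDr scalerA -red_scalC -scalerA.
Qed.
Definition even_act A D : lend MF := LEnd (act_linear_subproof A D).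

Lemma even_act_linear c A D A' D' : even_act (c *: A + A') (c *: D + D')
  = lend_scal MF c * even_act A D + even_act A' D'.
Proof.
have e : diag (c *: A + A') (c *: D + D') = c *: diag A D + diag A' D'.
  by rewrite scale_block_mx add_block_mx !scaler0 !addr0.
apply: lendP => v; rewrite -[LHS]/(Ge _ *: (v : M)) e gen_linear scalerDl.
by rewrite -scalerA.
Qed.

Lemma even_act_bracket A D A' D' :
  even_act A D * even_act A' D' - even_act A' D' * even_act A D
  = even_act (A *m A' - A' *m A) (D *m D' - D' *m D).
Proof.
apply: lendP => v; rewrite -[LHS]/(Ge (diag A D) *: (Ge (diag A' D') *: (v : M)) -
  Ge (diag A' D') *: (Ge (diag A D) *: (v : M))).
have e : sbracket false false (diag A D) (diag A' D') =
    diag (A *m A' - A' *m A) (D *m D' - D' *m D).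
  rewrite /sbracket scale1r !mulmx_block !mul0mx !mulmx0 !addr0 !add0r.
  by rewrite opp_block_mx add_block_mx !oppr0 !addr0.
rewrite -[RHS]/(Ge _ *: (v : M)) -e -gen_bracket ?e ?diag_gl_even //.
by rewrite mul1r scalerBl -!scalerA.
Qed.

Lemma even_act_pow A D : even_act A D ^+ p = even_act (A ^+ p) (D ^+ p)
  + lend_scal MF (chi (vsproj (gl_even F m n) (diag A D)) ^+ p).
Proof.
apply: lendP => v.
have powE k : (even_act A D ^+ k) v = Ge (diag A D) ^+ k *: (v : M).
  elim: k => [|k IH]; first by rewrite !expr0 scale1r.
  by rewrite !exprS -scalerA -IH.
rewrite powE gen_pow ?block_diag_expr ?diag_gl_even // scalerDl.
by [].
Qed.

Local Notation K := (coind m n MF).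
Local Notation upop := (@up_op F m n MF).
Local Notation evop := (even_op even_act).
Local Notation dnop := (down_op even_act_linear).

Definition kac_op (x : g) : lend K :=
  upop (ursubmx x) + (evop (ulsubmx x) (drsubmx x) + dnop (dlsubmx x)).

Lemma kac_op_block A B C D :
  kac_op (block_mx A B C D) = upop B + (evop A D + dnop C).
Proof.
by rewrite /kac_op block_mxKul block_mxKur block_mxKdl block_mxKdr.
Qed.

Lemma up_op0 : upop 0 = 0.
Proof. by rewrite -(subrr 0) up_opB subrr. Qed.
Lemma evop0 : evop 0 0 = 0.
Proof.
apply: (addIr (evop 0 0)); rewrite add0r.
have := even_op_linear even_act_linear 1 0 0 0 0.
by rewrite !scale1r !addr0 rmorph1 mul1r => <-.
Qed.
Lemma dnop0 : dnop 0 = 0.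
Proof.
apply: (addIr (dnop 0)); rewrite add0r.
have := down_op_linear even_act_linear 1 0 0.
by rewrite !scale1r !addr0 rmorph1 mul1r => <-.
Qed.

Lemma upopN B : upop (- B) = - upop B.
Proof. by rewrite -sub0r up_opB up_op0 sub0r. Qed.
Lemma dnopN C : dnop (- C) = - dnop C.
Proof.
have := down_op_linear even_act_linear (-1) C 0.
by rewrite scaleN1r !addr0 dnop0 addr0 rmorphN1 mulN1r.
Qed.

Lemma kac_op_linear c x y : kac_op (c *: x + y) = lend_scal K c * kac_op x + kac_op y.
Proof.
rewrite -[x]submxK -[y]submxK scale_block_mx add_block_mx !kac_op_block.
rewrite up_op_linear even_op_linear ?down_op_linear; try exact: even_act_linear.
by rewrite !mulrDr [X in _ + X]addrACA [LHS]addrACA.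
Qed.

Lemma gl_odd_diag (x : g) : x \in gl_par F m n true ->
  x = block_mx 0 (ursubmx x) (dlsubmx x) 0.
Proof.
case/memv_addP => y /mem_unit_span y0 [z /mem_unit_span z0 ->].
have lm (k : 'I_m) : (m <= k)%N = false by rewrite leqNgt ltn_ord.
have rm (k : 'I_n) : (m + k < m)%N = false by rewrite ltnNge leq_addr.
rewrite -[LHS]submxK; congr block_mx; apply/matrixP => i j.
  by rewrite !mxE y0 ?z0 ?addr0 //= lm andbF.
by rewrite !mxE y0 ?z0 ?addr0 //= rm.
Qed.

Lemma kac_op_bracket a b x y : x \in gl_par F m n a -> y \in gl_par F m n b ->
  kac_op x * kac_op y - (-1) ^+ (a && b) * (kac_op y * kac_op x)
  = kac_op (sbracket a b x y).
Proof.
have par (c : bool) (z : g) : z \in gl_par F m n c -> exists A B C D,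
   z = (if c then block_mx 0 B C 0 else block_mx A 0 0 D).
  move=> h; exists (ulsubmx z), (ursubmx z), (dlsubmx z), (drsubmx z).
  by case: c h => [/gl_odd_diag|/gl_even_diag].
move=> /par[A [B [C [D ->]]]] /par[A' [B' [C' [D' ->]]]] {par x y}.
case: a b => [] [] /=; rewrite /sbracket /= ?expr0 ?expr1 ?scaleN1r ?scale1r ?opprK
  ?mulN1r ?mul1r ?opprK !mulmx_block !mul0mx !mulmx0 !addr0 !add0r ?opp_block_mx
  !add_block_mx ?oppr0 ?addr0 ?add0r !kac_op_block ?up_op0 ?evop0 ?dnop0 ?addr0 ?add0r.
- rewrite !mulrDl !mulrDr !up_down_op (@up_up_op _ _ _ MF B') [C *m B' + _]addrC.
  have := even_op_linear even_act_linear 1 (B *m C') (C' *m B) (B' *m C) (C *m B').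
  rewrite !scale1r rmorph1 mul1r => ->.
  have /eqP := down_down_op even_act_linear even_act_bracket C C'.
  rewrite addr_eq0 => /eqP ->.
  move: (upop B * upop B') (dnop C * upop B') (dnop C' * upop B) (dnop C' * dnop C)
    (evop (B *m _) _)  (evop (B' *m _) _) => a1 a2 a3 a4 a5 a6.
  by zmove; zcancel a1; zcancel a2; zcancel a3; zcancel a4; zcancel a5; zcancel a6.
- rewrite mulrDl mulrDr up_even_op.
  have := even_down_op even_act_linear even_act_bracket A' D' C.
  rewrite -[C *m A' - _]opprB dnopN => <-.
  move: (_ * _) (upop _) (_ * _) (_ * _) => a1 a2 a3 a4.
  by zmove; zcancel a1; zcancel a2; zcancel a3; zcancel a4.
- rewrite mulrDl mulrDr up_even_op -[A *m B' - _]opprB upopN.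
  rewrite -(even_down_op even_act_linear even_act_bracket).
  move: (_ * _) (upop _) (_ * _) (_ * _) => a1 a2 a3 a4.
  by zmove; zcancel a1; zcancel a2; zcancel a3; zcancel a4.
- exact: (even_even_op even_act_bracket).
Qed.

(** With this, the coinduced space becomes a module over u(g, chi); the p-th power relation is
    [even_op_pow] applied to the action on M. *)
Lemma kac_op_rep :
  red_rep p chi (lend_scal K) (fun x : subvs_of {:g}%VS => kac_op (vsval x)).
Proof.
split=> [c s|c x y|a b x y z hx hy ->|x0 x xp -> ->].
- exact: lend_scalC.
- by rewrite linearP kac_op_linear.
- exact: kac_op_bracket.
- rewrite [vsval x0]gl_even_diag ?subvsP // block_diag_expr !kac_op_block.
  rewrite up_op0 dnop0 !addr0 !add0r.
  rewrite (even_op_pow pF po (even_act_pow _ _)) -gl_even_diag ?subvsP //.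
  by rewrite vsvalK.
Qed.

Definition kac_rep : {rmorphism redenv {:g}%VS p chi -> lend K} := red_lift kac_op_rep.

Fact vac_subproof (v : MF) :
  multilinear (fun w : seq 'M[F]_(m, n) => if w is [::] then v else 0) /\
  alternate (fun w : seq 'M[F]_(m, n) => if w is [::] then v else 0).
Proof.
by split=> [[|a u] c b b' w|[|a u] b b' w] /=; rewrite ?scaler0 ?addr0 ?oppr0.
Qed.
(** Supported on the empty word, hence killed by every shift: a copy of M inside the coinduced
    module on which gl_up acts by zero. *)
Definition vac (v : MF) : restrict kac_rep (lend_mod K) := coind_of (vac_subproof v).

Lemma vacD v w : vac (v + w) = vac v + vac w.
Proof.
by apply: coind_eq => -[|b u]; rewrite -[RHS]/(vac v _ + vac w _) //= addr0.
Qed.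

Lemma upop_vac b v : upop b (vac v) = 0.
Proof. by apply: coind_eq => w; rewrite -[RHS]/(0 : MF). Qed.

Lemma evop_vac A D v : evop A D (vac v) = vac (even_act A D v).
Proof.
apply: coind_eq => -[|b w] //=.
have -> : shift b (coind_val (vac v)) = 0 by apply: funext.
rewrite -[even_fun _ _ _ _ _]/(LEnd (even_fun_linear even_act A D) 0 w).
by rewrite lend0 -[(0 : seq _ -> MF) w]/(0 : MF) addr0.
Qed.

(** On generators: an element of gl_plus has no lower left block, its gl_up part kills [vac v], and
    its block diagonal part acts through M. *)
Lemma vac_act (b : redenv (gl_plus F m n) p chi) v :
  vac (b *: (v : inflate M)) = redenv_incl p chi (subvf (gl_plus F m n)) b *: vac v.
Proof.
move: b v; apply: redenv_semilinear => [|c v|x v]; first exact: vacD.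
- rewrite -[LHS]/(vac (redenv_even p chi (red_scal _ p chi c) *: (v : M))).
  rewrite -[RHS]/(kac_rep (redenv_incl p chi _ (red_scal _ p chi c)) (vac v)).
  rewrite !red_lift_scal; apply: coind_eq => -[|d w] //=.
  by rewrite -[RHS]/(c *: (0 : MF)) scaler0.
- rewrite -[LHS]/(vac (redenv_even p chi (red_gen p chi x) *: (v : M))).
  rewrite -[RHS]/(kac_rep (redenv_incl p chi _ (red_gen p chi x)) (vac v)).
  rewrite !red_lift_gen /incl vsprojK ?memvf //.
  have x0 : dlsubmx (vsval x) = 0.
    apply/matrixP => i j; rewrite !mxE (gl_plus0 (subvsP x)) //=.
    by rewrite ltn_ord leq_addr.
  rewrite /kac_op x0 dnop0 addr0 -[RHS]/(upop _ (vac v) + evop _ _ (vac v)).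
  rewrite upop_vac add0r evop_vac;
  rewrite -[RHS]/(vac (Ge (diag (ulsubmx (vsval x)) (drsubmx (vsval x))) *: (v : M))).
  suff <- : even_part (vsval x) = diag (ulsubmx (vsval x)) (drsubmx (vsval x)) by [].
  rewrite [LHS]gl_even_diag ?even_part_even //; congr block_mx;
  by apply/matrixP => i j; rewrite !mxE /= ?ltn_ord ?[(m + _ < m)%N]ltnNge ?leq_addr.
Qed.

(** If 1 (x) v were zero, so would be its image [vac v], whose value on the empty word is v. *)
Lemma kac_tens1_neq0 (v : M) : v <> 0 -> kac_tens 1 v <> 0.
Proof.
have h := @tens_eq0 _ _ (redenv_incl p chi (subvf (gl_plus F m n))) (inflate M)
  (restrict kac_rep (lend_mod K)) vac vacD vac_act 1 v.
move=> v0 /h; rewrite -[LHS]/(kac_rep 1 (vac v)) rmorph1.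
by move=> /(congr1 (fun phi : K => phi [::])); exact: v0.
Qed.
End KacNonzero.

(** * Eigenvectors and kernels inside stable subsets *)

Lemma rmorph_scaleC (F : comPzRingType) (R : pzRingType) (sc : {rmorphism F -> R})
  (V : lmodType R) c d (v : V) : sc c *: (sc d *: v) = sc d *: (sc c *: v).
Proof. by rewrite !scalerA -!rmorphM mulrC. Qed.

Section Eigenvector.
Variables (F : fieldType) (R : pzRingType) (sc : {rmorphism F -> R}) (V : lmodType R).
Hypothesis scC : forall c u, sc c * u = u * sc c.
Variable h : R.

(** This is q(h) v when q has size at most N; the length N is separate from q so that sums for
    different polynomials can be compared term by term. *)
Definition poly_act N (q : {poly F}) (v : V) : V :=
  \sum_(i < N) (sc q`_i * h ^+ i) *: v.

Lemma poly_act_factor N (q : {poly F}) r v : (size q <= N)%N ->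
  poly_act N.+1 (q * ('X - r%:P)) v = (h - sc r) *: poly_act N q v.
Proof.
move=> szq; rewrite scalerBl /poly_act !scaler_sumr.
under eq_bigr => i _ do rewrite mulrBr coefB coefMX coefMC rmorphB mulrBl scalerBl.
rewrite sumrB big_ord_recl /= rmorph0 mul0r scale0r add0r.
congr (_ - _); first by apply: eq_bigr => i _; rewrite scalerA exprS !mulrA scC.
rewrite big_ord_recr /= nth_default // mul0r rmorph0 mul0r scale0r addr0.
by apply: eq_bigr => i _; rewrite scalerA mulrC rmorphM mulrA.
Qed.

Lemma poly_act_prod (rs : seq F) v :
  poly_act (size rs).+1 (\prod_(r <- rs) ('X - r%:P)) v
  = foldr (fun r w => (h - sc r) *: w) v rs.
Proof.
elim: rs => [|r rs IH].
  by rewrite big_nil /poly_act big_ord1 coef1 rmorph1 mul1r expr0 scale1r.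
by rewrite big_cons mulrC /= poly_act_factor ?size_prod_XsubC // IH.
Qed.

(** Apply the factors one by one: the last nonzero partial product is killed by the next factor. *)
Lemma root_factor_kernel (S : V -> Prop) (rs : seq F) v :
  (forall r w, S w -> S ((h - sc r) *: w)) -> S v -> v <> 0 ->
  foldr (fun r w => (h - sc r) *: w) v rs = 0 ->
  exists w r, [/\ S w, w <> 0 & h *: w = sc r *: w].
Proof.
move=> Sh Sv v0; elim: rs => [//|r rs IH] /= e.
have [/IH//|w0] := pselect (foldr (fun r w => (h - sc r) *: w) v rs = 0).
exists (foldr (fun r w => (h - sc r) *: w) v rs), r; split=> //.
  by elim: (rs) => //= r' rs' IHs; apply: Sh.
by apply: subr0_eq; rewrite -scalerBl.
Qed.
End Eigenvector.

(** X^p - X - a splits over F and vanishes at h, so the product of the h - r over its roots kills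
    v. *)
Lemma artin_schreier_eigenvector (F : closedFieldType) (R : pzRingType)
    (sc : {rmorphism F -> R}) (V : lmodType R) (h : R) (p : nat) (a : F)
    (S : V -> Prop) v :
  (1 < p)%N -> (forall c u, sc c * u = u * sc c) -> h ^+ p = h + sc a ->
  (forall r w, S w -> S ((h - sc r) *: w)) -> S v -> v <> 0 ->
  exists w r, [/\ S w, w <> 0 & h *: w = sc r *: w].
Proof.
move=> p1 scC hp Sh Sv v0; pose q : {poly F} := 'X^p - ('X + a%:P).
have szq : size q = p.+1.
  by rewrite size_polyDl size_polyXn // size_polyN size_XaddC.
have [rs rsE] := closed_field_poly_normal q.
have lq : lead_coef q = 1.
  by rewrite lead_coefDl ?lead_coefXn // size_polyXn size_polyN size_XaddC.
rewrite lq scale1r in rsE.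
have szrs : size rs = p by have := szq; rewrite rsE size_prod_XsubC => -[].
apply: (root_factor_kernel (rs := rs) Sh Sv v0).
rewrite -(poly_act_prod scC) -rsE szrs /poly_act -scaler_suml.
rewrite [X in X *: _](_ : _ = 0) ?scale0r //.
(* Each of the three monomials of q is isolated as a sum over i < p + 1; together they give h^p - (h
   + a) = 0. *)
have monom k c : (k < p.+1)%N -> \sum_(i < p.+1) sc (c * ((i : nat) == k)%:R) * h ^+ i
    = sc c * h ^+ k.
  move=> kp; rewrite (bigD1 (Ordinal kp)) //= eqxx mulr1 big1 ?addr0 // => i.
  by rewrite -val_eqE /= => /negPf ->; rewrite mulr0 rmorph0 mul0r.
have := monom p 1 (ltnSn p); have := monom 1 1 (ltnW p1); have := monom 0 a isT.
rewrite rmorph1 !mul1r expr0 expr1 mulr1 hp => e0 e1 ep.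
rewrite -[RHS](subrr (h + sc a)) -[X in X - _]ep -e0 -[X in _ - (X + _)]e1.
rewrite -big_split -sumrB /=; apply: eq_bigr => i _.
rewrite /q coefB coefXn coefD coefX coefC !mul1r !(rmorphB, rmorphD) /= !(mulrBl, mulrDl).
by case: (i == 0 :> nat); rewrite ?mulr1 ?mulr0.
Qed.

Lemma nilpotent_kernel (R : pzRingType) (V : lmodType R) (h : R) (S : V -> Prop) p v :
  h ^+ p = 0 -> (forall w, S w -> S (h *: w)) -> S v -> v <> 0 ->
  exists w, [/\ S w, w <> 0 & h *: w = 0].
Proof.
move=> hp Sh Sv v0.
have : h ^+ p *: v = 0 by rewrite hp scale0r.
elim: p {hp} => [|p IH]; first by rewrite expr0 scale1r.
rewrite exprS -scalerA => e.
have [/IH//|w0] := pselect (h ^+ p *: v = 0).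
exists (h ^+ p *: v); split=> //; elim: (p) => [|k IHk]; first by rewrite scale1r.
by rewrite exprS -scalerA; apply: Sh.
Qed.

(** * Highest weight vectors for the even part *)

Section HighestWeight.
Variables (F : closedFieldType) (m n p : nat) (chi : {scalar subvs_of (gl_even F m n)}).
Hypotheses (p_gt1 : (1 < p)%N) (chi_ss : semisimple_char chi).
Variable M : lmodType (redenv (gl_even F m n) p chi).
Local Notation g := 'M[F]_(m + n).
Local Notation Ge := (gen p chi (gl_even F m n)).
Local Notation sce := (red_scal (gl_even F m n) p chi).
Local Notation E i j := (Ge (delta_mx i j)).

Let evn (i j : 'I_(m + n)) := (i < m)%N == (j < m)%N.

Lemma even_delta_comm i j k l : evn i j -> evn k l ->
  E i j * E k l = E k l * E i j + E i l *+ (j == k) - E k j *+ (l == i).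
Proof.
move=> ij kl; apply/eqP; rewrite -addrA addrC -subr_eq; apply/eqP.
have e : sbracket false false (delta_mx i j) (delta_mx k l) =
    delta_mx i l *+ (j == k) - delta_mx k j *+ (l == i) :> g.
  by rewrite sbracket_delta scale1r.
have := @gen_bracket F m n p chi (gl_even F m n) false false
  (delta_mx i j) (delta_mx k l).
rewrite mul1r e genB => ->; rewrite ?delta_gl_even //.
  by congr (_ - _); [case: (j == k) | case: (l == i)]; rewrite ?mulr0n ?gen0.
apply: memvB; [case: eqP => [jk|] | case: eqP => [li|]]; rewrite ?mem0v // mulr1n;
  apply: delta_gl_even; move/eqP: ij => ij; move/eqP: kl => kl.
  by rewrite ij jk kl.
by rewrite kl li ij.
Qed.

(** An off-diagonal matrix unit has p-th power zero, and chi vanishes on it by semisimplicity. *)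
Lemma even_root_nilpotent i j : i != j -> evn i j -> E i j ^+ p = 0.
Proof.
move=> ij eij; have e0 : (delta_mx i j : g) ^+ p = 0.
  case: p p_gt1 => [|[|q]] // _.
  rewrite !exprS mulrA [delta_mx i j * _]mul_delta_mx_cond.
  by rewrite eq_sym (negPf ij) mulr0n mul0r.
rewrite gen_pow ?e0 ?mem0v ?delta_gl_even // gen0 add0r.
have p0 : (p == 0)%N = false by case: (p) p_gt1.
by rewrite chi_ss ?delta_gl_even // expr0n p0 rmorph0.
Qed.

Lemma highest_vector v : v <> 0 :> M -> exists w : M, w <> 0 /\
  forall i j : 'I_(m + n), (i < j)%N -> evn i j -> E i j *: w = 0.
Proof.
move=> v0; pose killed N (w : M) := forall i j : 'I_(m + n), (i < j)%N -> evn i j ->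
  (i * (m + n) + j < N)%N -> E i j *: w = 0.
have [w [w0 kw]] : exists w, w <> 0 /\ killed ((m + n) * (m + n))%N w; last first.
  exists w; split=> // i j ij e; apply: kw => //.
  by have := ltn_ord i; have := ltn_ord j; nia.
(* By rows from the top, each new root vector preserves the vectors killed by the
   earlier ones. *)
elim: (_ * _)%N => [|N [w [w0 kw]]]; first by exists v.
have [[[i j] /= [ij e rN]]|no] := pselect (exists ij : 'I_(m + n) * 'I_(m + n),
    [/\ (ij.1 < ij.2)%N, evn ij.1 ij.2 & (ij.1 * (m + n) + ij.2)%N = N]); last first.
  exists w; split=> // i j ij e; rewrite ltnS leq_eqVlt => /orP[/eqP rN|]; last exact: kw.
  by case: no; exists (i, j).
have inj : i != j by apply: contraTneq ij => ->; rewrite ltnn.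
have stable u : killed N u -> killed N (E i j *: u).
  move=> ku k l kl ekl rkl; rewrite scalerA even_delta_comm //.
  rewrite scalerBl scalerDl -scalerA ku // scaler0 add0r.
  case: eqP => [li|_]; last first.
    rewrite mulr0n scale0r add0r; case: eqP => [jk'|_]; last first.
      by rewrite mulr0n scale0r oppr0.
    by subst k; move: rkl; rewrite -rN; have := ltn_ord l; have := ltn_ord j; nia.
  subst l; rewrite mulr1n ku ?add0r //; last first.
  - by rewrite -rN; have := ltn_ord j; nia.
  - by rewrite /evn (eqP ekl) (eqP e).
  - exact: ltn_trans ij.
  case: eqP => [jk'|_]; last by rewrite mulr0n scale0r oppr0.
  by subst k; move: (ltn_trans ij kl); rewrite ltnn.
have [u [ku u0 Eu]] := nilpotent_kernel (even_root_nilpotent inj e) stable kw w0.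
exists u; split=> // k l kl ekl.
rewrite ltnS leq_eqVlt => /orP[/eqP rkl|]; last exact: ku.
suff [-> ->] : k = i /\ l = j by [].
have := ltn_ord l; have := ltn_ord j; move: rkl; rewrite -rN => e1 lj ll.
have ki : (k : nat) = i by nia.
by split; apply: val_inj => //=; nia.
Qed.

(** The e_kk are diagonalised one at a time: each preserves the vectors killed by the positive even
    root vectors, and also the eigenvector conditions already reached. *)
Lemma highest_weight_vector v : v <> 0 :> M -> exists w : M, [/\ w <> 0,
  forall i j : 'I_(m + n), (i < j)%N -> evn i j -> E i j *: w = 0 &
  forall i, exists c, E i i *: w = sce c *: w].
Proof.
move=> /highest_vector[w0 [w00 kw0]].
pose good N (w : M) :=
  (forall i j : 'I_(m + n), (i < j)%N -> evn i j -> E i j *: w = 0) /\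
  forall i : 'I_(m + n), (i < N)%N -> exists c, E i i *: w = sce c *: w.
have [w [gw w0']] : exists w, good (m + n)%N w /\ w <> 0; last first.
  by exists w; case: gw => [kw ew]; split=> // i; apply: ew.
suff : forall N, (N <= m + n)%N -> exists w, good N w /\ w <> 0 by apply.
elim=> [|N IH] lN; first by exists w0; split=> //; split.
have [w [gw wn0]] := IH (ltnW lN); pose k := Ordinal lN.
have scE c i j (u : M) : E i j *: (sce c *: u) = sce c *: (E i j *: u).
  by rewrite !scalerA red_scalC.
have stable r u : good N u -> good N ((E k k - sce r) *: u).
  move=> [ku eu]; rewrite scalerBl; split=> [i j ij e|i iN].
    rewrite scalerBr scE (ku i j) // scaler0 subr0 scalerA.
    rewrite even_delta_comm //; last exact: eqxx.
    rewrite scalerBl scalerDl -scalerA (ku i j) // scaler0 add0r.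
    have -> : (E i k *+ (j == k)) *: u = 0.
      by case: eqP => [<-|_]; rewrite ?mulr1n ?ku ?scale0r.
    have -> : (E k j *+ (k == i)) *: u = 0.
      by case: eqP => [->|_]; rewrite ?mulr1n ?ku ?scale0r.
    by rewrite subrr.
  have [c ec] := eu i iN; exists c.
  have ik : (i == k) = false by apply: contraTF iN => /eqP ->; rewrite ltnn.
  have comm : E i i * E k k = E k k * E i i.
    by rewrite even_delta_comm /evn ?eqxx // [k == i]eq_sym ik !mulr0n addr0 subr0.
  have e1 : E i i *: (E k k *: u) = sce c *: (E k k *: u).
    by rewrite scalerA comm -(scalerA (E k k)) ec scE.
  have e2 : E i i *: (sce r *: u) = sce c *: (sce r *: u).
    by rewrite scE ec; exact: rmorph_scaleC.
  by rewrite (scalerBr (E i i)) e1 e2 -(scalerBr (sce c)).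
(* The matrix unit e_kk is idempotent, so the p-th power relation becomes an Artin-Schreier
   equation. *)
have hp : E k k ^+ p = E k k + sce (chi (vsproj (gl_even F m n) (delta_mx k k)) ^+ p).
  have ek : delta_mx k k \in gl_even F m n by apply: delta_gl_even; exact: eqxx.
  have idem q : (0 < q)%N -> (delta_mx k k : g) ^+ q = delta_mx k k.
    elim: q => // -[|q] IHq _; first by rewrite expr1.
    by rewrite exprS IHq // [_ * _]mul_delta_mx.
  have := @gen_pow F m n p chi _ _ ek ek; rewrite (idem p (ltnW p_gt1)).
  by apply; exact: ek.
have [u [c [[ku eu] u0 hu]]] :=
  artin_schreier_eigenvector p_gt1 (@red_scalC _ _ _ _ _ _) hp stable gw wn0.
exists u; split=> //; split=> // i.
rewrite ltnS leq_eqVlt => /orP[/eqP iN|]; last exact: eu.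
by exists c; have -> : i = k by apply: val_inj.
Qed.
End HighestWeight.

(** * Graded simplicity over a purely even algebra *)

Section SimpleModule.
Variables (F : fieldType) (m n p : nat) (chi : {scalar subvs_of (gl_even F m n)}).
Variable M : lmodType (redenv (gl_even F m n) p chi).
Variable dM : bool -> M -> Prop.
Hypotheses (M_graded : graded_module (@red_par F m n (gl_even F m n) p chi) dM)
  (M_simple : graded_simple dM).

Lemma even_redenv_par (u : redenv (gl_even F m n) p chi) : red_par false u.
Proof.
elim/redenv_ind: u => [c|x|u v|u v hu hv].
- exact: red_par_scal.
- by apply: red_par_gen; exact: subvsP.
- exact: red_parD.
- exact: (red_parM hu hv).
Qed.

(** As u(gl_even, chi) is purely even, the even part of M is a graded submodule, hence zero or
    everything. *)
Lemma simple_even_homogeneous : exists a, forall v, dM a v.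
Proof.
case: M_graded => dB dsum d0 dact; case: M_simple => _ /(_ (dM false)) [].
- split=> [|v w hv hw|x v hv|v hv].
  + by case: (dB false).
  + rewrite -[w]opprK -[- w]sub0r; case: (dB false) => z hB.
    exact: (hB _ _ hv (hB _ _ z hw)).
  + by have := dact _ _ _ _ (even_redenv_par x) hv.
  + by exists v, 0; split; [|split; case: (dB true); case: (dB false)|rewrite addr0].
- move=> h; exists true => v; have [v0 [v1 [h0 h1 ->]]] := dsum v.
  by rewrite (h _ h0) add0r.
- by exists false.
Qed.

(** M lives in a single parity, so every submodule is automatically graded. *)
Lemma simple_even_ungraded (N : M -> Prop) v : (forall v w, N v -> N w -> N (v + w)) ->
  (forall x v, N v -> N (x *: v)) -> N v -> v <> 0 -> forall w, N w.
Proof.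
move=> ND NZ Nv v0; case: M_simple => _ /(_ N) [] //; last by move/(_ v Nv)/v0.
have N0 : N 0 by rewrite -(scale0r v); apply: NZ.
have dz a : dM a 0 by case: M_graded => /(_ a) [].
split=> // w Nw; have [[] ha] := simple_even_homogeneous.
  by exists 0, w; split; rewrite ?add0r.
by exists w, 0; split; rewrite ?addr0.
Qed.
End SimpleModule.

(** * Words in anticommuting letters of square zero *)

Section Exterior.
Variables (F : fieldType) (R : pzRingType) (sc : {rmorphism F -> R}).
Hypothesis scC : forall c u, sc c * u = u * sc c.
Variables (I : eqType) (f : I -> R).
Hypothesis fC : forall a b, f a * f b = - (f b * f a).
Hypothesis f2 : forall a, f a * f a = 0.

Definition word (s : seq I) : R := \prod_(a <- s) f a.

Lemma word_cons a s : word (a :: s) = f a * word s.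
Proof. exact: big_cons. Qed.
Lemma word_cat s t : word (s ++ t) = word s * word t.
Proof. exact: big_cat. Qed.

Lemma word_letter s a : word s * f a = (-1) ^+ size s * (f a * word s).
Proof.
elim: s => [|b s IH]; first by rewrite /word big_nil mul1r mulr1 expr0 mul1r.
rewrite word_cons -mulrA IH (mulrA (f b)) commr_sign -mulrA (mulrA (f b)) fC.
by rewrite exprS mulN1r !mulNr mulrN !mulrA.
Qed.

Lemma letter_word0 a s : a \in s -> f a * word s = 0.
Proof.
elim: s => // b s IH; rewrite inE word_cons mulrA => /orP[/eqP->|/IH e].
  by rewrite f2 mul0r.
by rewrite fC mulNr -mulrA e mulr0 oppr0.
Qed.

Lemma word_letter0 a s : a \in s -> word s * f a = 0.
Proof. by move=> /letter_word0; rewrite word_letter => ->; rewrite mulr0. Qed.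

Lemma letter_word_letter0 a s : f a * word s * f a = 0.
Proof.
rewrite -mulrA word_letter (mulrA (f a)) commr_sign -mulrA (mulrA (f a)) f2.
by rewrite mul0r mulr0.
Qed.

(** Moving x through the word replaces one letter a by letters b. If b differs from a it already
    occurs elsewhere and the term dies; only diagonal coefficients survive. When each letter is
    listed once, c is the trace of the matrix k. *)
Lemma top_word_character (s : seq I) (x : R) (k : I -> I -> F) (r : seq I) :
  (forall a, a \in s) -> (forall a, x * f a = f a * x + \sum_(b <- r) sc (k a b) * f b) ->
  exists c, x * word s = word s * x + sc c * word s.
Proof.
move=> s_all hx.
(* Generalised to a splitting of s, with s1 the prefix that x has already crossed. *)
suff /(_ [::] s erefl) [c hc] : forall s1 s2, s1 ++ s2 = s ->
    exists c, word s1 * (x * word s2 - word s2 * x) = sc c * word s.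
  by exists c; move: hc; rewrite /word big_nil mul1r => <-; rewrite addrC subrK.
move=> s1 s2; elim: s2 s1 => [|a s2 IH] s1 es.
  exists 0; rewrite rmorph0 mul0r [word [::]]big_nil.
  by rewrite mul1r mulr1 subrr mulr0.
have [|c hc] := IH (rcons s1 a); first by rewrite cat_rcons.
have [d hd] : exists d,
    word s1 * (\sum_(b <- r) sc (k a b) * f b) * word s2 = sc d * word s.
  elim: (r) => [|b r' [d hd]].
    by exists 0; rewrite big_nil mulr0 mul0r rmorph0 mul0r.
  have hb : word s1 * (sc (k a b) * f b) * word s2 =
      sc (k a b) * (word s1 * f b * word s2).
    by rewrite !mulrA scC.
  rewrite big_cons mulrDr mulrDl hd hb; have [->|ba] := eqVneq b a.
    exists (k a a + d); rewrite rmorphD mulrDl; congr (_ * _ + _).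
    by rewrite -es word_cat word_cons mulrA.
  (* Since b is not a, it occurs in s1 or in s2, and the term has a repeated letter. *)
  exists d; have : b \in s by []. 
  rewrite -es mem_cat inE (negPf ba) /= => /orP[/word_letter0->|/letter_word0 e].
    by rewrite mul0r mulr0 add0r.
  by rewrite -mulrA e !mulr0 add0r.
have e : x * word (a :: s2) - word (a :: s2) * x =
    f a * (x * word s2 - word s2 * x) + (\sum_(b <- r) sc (k a b) * f b) * word s2.
  by rewrite word_cons mulrA hx mulrDl mulrBr !mulrA addrAC.
exists (c + d); rewrite rmorphD mulrDl -hc -hd e -cats1 word_cat [word [:: a]]big_seq1.
by rewrite mulrDr !mulrA.
Qed.

Variables (V : lmodType R) (M : zmodType) (base : M -> V).
Hypothesis baseD : {morph base : v w / v + w}.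

(** The span of the f_S base v, for S a sublist of s in order; each step separates the part without
    f_a from the part with it. *)
Fixpoint ext_span (s : seq I) (z : V) : Prop :=
  if s is a :: s' then exists u u', [/\ ext_span s' u, ext_span s' u' & z = u + f a *: u']
  else exists v, z = base v.

Let base0 : base 0 = 0.
Proof. by apply: (addIr (base 0)); rewrite -baseD !add0r. Qed.
Let baseN v : base (- v) = - base v.
Proof. by apply: (addIr (base v)); rewrite -baseD !addNr base0. Qed.

Lemma ext_span_base s v : ext_span s (base v).
Proof.
elim: s v => [|a s IH] v /=; first by exists v.
by exists (base v), (base 0); rewrite [in f a *: _]base0 scaler0 addr0; split.
Qed.

Lemma ext_spanD s z w : ext_span s z -> ext_span s w -> ext_span s (z + w).
Proof.
elim: s z w => [|a s IH] z w /=.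
  by move=> [v ->] [v' ->]; exists (v + v'); rewrite baseD.
move=> [u [u' [hu hu' ->]]] [v [v' [hv hv' ->]]].
exists (u + v), (u' + v'); rewrite scalerDr addrACA; split=> //; exact: IH.
Qed.

Lemma ext_spanN s z : ext_span s z -> ext_span s (- z).
Proof.
elim: s z => [|a s IH] z /=; first by move=> [v ->]; exists (- v); rewrite baseN.
move=> [u [u' [hu hu' ->]]]; exists (- u), (- u'); rewrite opprD scalerN.
by split=> //; exact: IH.
Qed.

Lemma ext_spanZ s c z : (forall v, exists w, sc c *: base v = base w) ->
  ext_span s z -> ext_span s (sc c *: z).
Proof.
move=> hb; elim: s z => [|a s IH] z /=; first by move=> [v ->].
move=> [u [u' [hu hu' ->]]]; exists (sc c *: u), (sc c *: u').
by rewrite scalerDr !scalerA scC; split=> //; exact: IH.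
Qed.

Lemma ext_span_letter s a z : a \in s -> ext_span s z -> ext_span s (f a *: z).
Proof.
elim: s z => // b s IH z; rewrite inE => ab /= [u [u' [hu hu' ->]]].
rewrite scalerDr scalerA; have [->|nab] := eqVneq a b.
  exists (base 0), u; split=> //; first exact: ext_span_base.
  by rewrite f2 scale0r addr0 base0 add0r.
rewrite (negPf nab) in ab.
exists (f a *: u), (- (f a *: u')); split; first exact: IH.
  by apply: ext_spanN; apply: IH.
by rewrite fC scaleNr -scalerA scalerN.
Qed.

(* Multiplying by letters pushes one of the shortest terms of [z] to the top degree
   and kills the others. *)
Lemma ext_span_top s z : ext_span s z -> z <> 0 ->
  exists t v, v <> 0 /\ word t *: z = word s *: base v.
Proof.
elim: s z => [|a s IH] z /=.
  move=> [v ->] v0; exists [::], v; split=> // v0'; apply: v0.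
  by rewrite v0' base0.
(* If u vanishes, every term already contains f_a and only a sign appears. Otherwise f_a is one of
   the missing letters, and multiplying by it kills the u' part. *)
move=> [u [u' [hu hu' ->]]]; have [u0|u0] := pselect (u = 0).
  rewrite u0 add0r => fu0; have u'0 : u' <> 0 by move=> e; rewrite e scaler0 in fu0.
  have [t [v [v0 e]]] := IH _ hu' u'0.
  exists t, (if odd (size t) then - v else v); split.
    by case: ifP => // _ /eqP; rewrite oppr_eq0 => /eqP.
  rewrite scalerA word_letter -scalerA -(scalerA (f a)) e word_cons -[RHS]scalerA.
  rewrite -signr_odd.
  by case: odd; rewrite ?expr1 ?expr0 ?scale1r ?scaleN1r ?baseN ?scalerN.
move=> _; have [t [v [v0 e]]] := IH _ hu u0.
exists (a :: t), v; split=> //; rewrite scalerDr scalerA !word_cons.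
by rewrite letter_word_letter0 scale0r addr0 -!scalerA e.
Qed.
End Exterior.

(** * Odd reflections from 1 (x) w to the top degree *)

Section OddReflections.
Variables (F : fieldType) (R : pzRingType) (sc : {rmorphism F -> R}).
Hypothesis scC : forall c u, sc c * u = u * sc c.
Variables (m n p : nat) (E : 'I_(m + n) -> 'I_(m + n) -> R).
Hypothesis two_neq0 : (2%:R : F) != 0.
Hypothesis p_gt0 : (0 < p)%N.
Hypothesis E_rel : forall i j k l,
  E i j * E k l - (-1) ^+ (unit_odd i j && unit_odd k l) * (E k l * E i j)
  = E i l *+ (j == k) - (-1) ^+ (unit_odd i j && unit_odd k l) * E k j *+ (l == i).

Local Notation lft := (lshift n).
Local Notation rgt := (@rshift m n).

Definition down_letter (a : 'I_m * 'I_n) : R := E (rgt a.2) (lft a.1).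
Local Notation f := down_letter.

Lemma lft_lt (i : 'I_m) : (lft i < m)%N. Proof. exact: (ltn_ord i). Qed.
Lemma rgt_lt (j : 'I_n) : (rgt j < m)%N = false.
Proof. by rewrite /= ltnNge leq_addr. Qed.

Lemma down_letterC a b : f a * f b = - (f b * f a).
Proof.
have := E_rel (rgt a.2) (lft a.1) (rgt b.2) (lft b.1).
rewrite /unit_odd !lft_lt !rgt_lt /= expr1 !mulN1r opprK !eq_lrshift.
by rewrite !mulr0n subr0 => /eqP; rewrite addr_eq0 => /eqP.
Qed.

Lemma down_letter2 a : f a * f a = 0.
Proof.
have /eqP := down_letterC a a; rewrite -addr_eq0 => /eqP e.
have : sc 2%:R * (f a * f a) = 0 by rewrite mulr2n rmorphD rmorph1 mulrDl mul1r.
move/(congr1 (fun u => sc 2%:R^-1 * u)).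
by rewrite mulrA -rmorphM mulVf // rmorph1 mul1r mulr0.
Qed.

Lemma even_letter k l a : ~~ unit_odd k l ->
  E k l * f a = f a * E k l + E k (lft a.1) *+ (l == rgt a.2)
    - E (rgt a.2) l *+ (lft a.1 == k).
Proof.
move=> kl; apply/eqP; rewrite -addrA addrC -subr_eq; apply/eqP.
have := E_rel k l (rgt a.2) (lft a.1); rewrite (negPf kl) /= expr0 !mul1r.
by move=> ->.
Qed.

Lemma up_letter i j a :
  E (lft i) (rgt j) * f a = - (f a * E (lft i) (rgt j))
    + E (lft i) (lft a.1) *+ (j == a.2) + E (rgt a.2) (rgt j) *+ (a.1 == i).
Proof.
apply/eqP; rewrite -addrA addrC -subr_eq opprK; apply/eqP.
have := E_rel (lft i) (rgt j) (rgt a.2) (lft a.1).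
rewrite /unit_odd !lft_lt !rgt_lt /= expr1 !mulN1r !opprK eq_lshift eq_rshift.
by rewrite mulNrn opprK.
Qed.

Variable chi : 'I_m -> 'I_n -> F.
Hypothesis chi0 : forall i j, chi i j != 0.
Hypothesis E_pow : forall i j, (E (lft i) (lft i) + E (rgt j) (rgt j)) ^+ p
  = E (lft i) (lft i) + E (rgt j) (rgt j) + sc (chi i j).

Variables (V : lmodType R) (N : V -> Prop) (w0 : V).
Hypothesis NZ : forall u v, N v -> N (u *: v).
Hypothesis w0_neq0 : w0 <> 0.
Hypothesis w0_even : forall k l : 'I_(m + n), (k < l)%N -> ~~ unit_odd k l ->
  E k l *: w0 = 0.
Hypothesis w0_up : forall i j, E (lft i) (rgt j) *: w0 = 0.
Hypothesis w0_diag : forall k, exists c, E k k *: w0 = sc c *: w0.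

(* The roots whose negatives have already been reflected form [t]. *)
Record borel_vector (t : seq ('I_m * 'I_n)) (w : V) : Prop := BorelVector {
  bv_neq0 : w <> 0;
  bv_even : forall k l : 'I_(m + n), (k < l)%N -> ~~ unit_odd k l -> E k l *: w = 0;
  bv_up : forall a, a \notin t -> E (lft a.1) (rgt a.2) *: w = 0;
  bv_down : forall a, a \in t -> f a *: w = 0;
  bv_diag : forall k, exists c, E k k *: w = sc c *: w }.

(** As e_a kills w, e_a f_a w = h_a w, so the coefficient is the eigenvalue of h_a. *)
Lemma odd_reflection_coef t w (a : 'I_m * 'I_n) : borel_vector t w -> a \notin t ->
  exists c, c != 0 /\ E (lft a.1) (rgt a.2) *: (f a *: w) = sc c *: w.
Proof.
case=> w_neq0 _ wu _ wd ant.
have [c hc] := wd (lft a.1); have [d hd] := wd (rgt a.2).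
set h := E (lft a.1) (lft a.1) + E (rgt a.2) (rgt a.2).
have hw : h *: w = sc (c + d) *: w by rewrite scalerDl hc hd rmorphD scalerDl.
exists (c + d); split; last first.
  rewrite scalerA up_letter !eqxx !mulr1n -addrA scalerDl -/h hw scaleNr -scalerA wu //.
  by rewrite scaler0 oppr0 add0r.
(* A zero eigenvalue would give 0 = h^p w = h w + chi w = chi w, although chi is nonzero at this
   root and w is nonzero. *)
apply/negP => /eqP cd0; rewrite cd0 rmorph0 scale0r in hw.
have : h ^+ p *: w = 0 by case: p p_gt0 => // q _; rewrite exprSr -scalerA hw scaler0.
rewrite E_pow -/h scalerDl hw add0r => /(congr1 (fun v => sc (chi a.1 a.2)^-1 *: v)).
by rewrite scalerA -rmorphM mulVf // rmorph1 scale1r scaler0.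
Qed.

(** The last four hypotheses say that a is simple for the current Borel subalgebra. The commutator
    of an even positive root vector with f_a is, up to sign, zero or some f_b with b already
    reflected, and the anticommutator of e_b with f_a, for b not yet reflected and other than a, is
    zero or an even positive root vector. All of these kill w. *)
Lemma odd_reflection t w (a : 'I_m * 'I_n) : borel_vector t w -> a \notin t ->
  (forall i' : 'I_m, (a.1 < i')%N -> (i', a.2) \in t) ->
  (forall j' : 'I_n, (j' < a.2)%N -> (a.1, j') \in t) ->
  (forall b, b \notin a :: t -> b.2 = a.2 -> (b.1 < a.1)%N) ->
  (forall b, b \notin a :: t -> b.1 = a.1 -> (a.2 < b.2)%N) ->
  borel_vector (a :: t) (f a *: w).
Proof.
move=> bw ant ht1 ht2 hn1 hn2; have [c [c0 hc]] := odd_reflection_coef bw ant.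
case: bw => w_neq0 we wu wn wd; split.
- move=> e; rewrite e scaler0 in hc; move/esym/(congr1 (fun v => sc c^-1 *: v)): hc.
  by rewrite scalerA -rmorphM mulVf // rmorph1 scale1r scaler0.
- move=> k l kl ekl.
  rewrite scalerA even_letter // scalerBl scalerDl -scalerA we // scaler0 add0r.
  have -> : (E k (lft a.1) *+ (l == rgt a.2)) *: w = 0.
    case: eqP => [el|_]; last by rewrite mulr0n scale0r.
    subst l; rewrite mulr1n; move: ekl kl.
    case: (split_ordP k) => k' -> ekl kl.
      by move: ekl; rewrite /unit_odd lft_lt rgt_lt.
    by apply: (wn (a.1, k')); apply: ht2; rewrite -(ltn_add2l m).
  have -> : (E (rgt a.2) l *+ (lft a.1 == k)) *: w = 0.
    case: eqP => [ek|_]; last by rewrite mulr0n scale0r.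
    subst k; rewrite mulr1n; move: ekl kl.
    case: (split_ordP l) => l' -> ekl kl; last first.
      by move: ekl; rewrite /unit_odd lft_lt rgt_lt.
    by apply: (wn (l', a.2)); apply: ht1.
  by rewrite subrr.
- move=> b nb; have nbt : b \notin t by move: nb; rewrite inE negb_or => /andP[].
  rewrite scalerA up_letter !scalerDl scaleNr -scalerA wu // scaler0 oppr0 add0r.
  have -> : (E (lft b.1) (lft a.1) *+ (b.2 == a.2)) *: w = 0.
    case: eqP => [/(hn1 _ nb) lt|_]; last by rewrite mulr0n scale0r.
    by rewrite mulr1n we // /unit_odd !lft_lt.
  case: eqP => [/esym/(hn2 _ nb) lt|_]; last by rewrite mulr0n scale0r addr0.
  by rewrite mulr1n we ?addr0 //= ?ltn_add2l // /unit_odd !rgt_lt.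
- move=> b; rewrite inE scalerA => /orP[/eqP->|bt]; first by rewrite down_letter2 scale0r.
  by rewrite down_letterC scaleNr -scalerA wn // scaler0 oppr0.
- move=> k; have [d hd] := wd k; exists (d + (k == rgt a.2)%:R - (lft a.1 == k)%:R).
  rewrite scalerA even_letter; last by rewrite /unit_odd eqxx.
  rewrite rmorphB rmorphD !scalerBl !scalerDl -scalerA hd.
  rewrite !rmorph_nat; congr (_ + _ - _).
  + by rewrite !scalerA scC.
  + by case: eqP => [->|_]; rewrite ?mulr1n ?mulr0n ?scale0r ?scale1r.
  + by case: eqP => [<-|_]; rewrite ?mulr1n ?mulr0n ?scale0r ?scale1r.
Qed.

(* The order of the reflections, from the last one to the first one. *)
Definition odd_rank (a : 'I_m * 'I_n) := (a.1 * n + (n - a.2))%N.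

(** Induction on the reflected tail t. The ordering by [odd_rank] makes each new root simple at its
    turn, starting with the last row index and the first column index. *)
Lemma odd_reflections s t : uniq (s ++ t) -> (forall a, a \in s ++ t) ->
  pairwise (fun a b => odd_rank a <= odd_rank b)%N (s ++ t) ->
  borel_vector t (word f t *: w0) /\ (N (word f t *: w0) -> N w0).
Proof.
elim: t s => [|a t IH] s us all_s ps.
  rewrite /word big_nil scale1r; split=> //; split=> //.
have [] := IH (rcons s a); rewrite ?cat_rcons // => bt Nt.
have ant : a \notin t by move: us; rewrite cat_uniq /= => /and3P[_ _ /andP[]].
move: ps; rewrite pairwise_cat /= => /and3P[/allrelP ps _ /andP[_ _]].
have before b : b \notin a :: t -> (odd_rank b <= odd_rank a)%N.
  move=> nb; apply: ps; last exact: mem_head.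
  by have := all_s b; rewrite mem_cat (negPf nb) orbF.
have after b : (odd_rank a < odd_rank b)%N -> b \in t.
  move=> ab; have : b \in a :: t by apply: contraLR ab => /before; rewrite -leqNgt.
  by rewrite inE => /orP[/eqP ba|//]; move: ab; rewrite ba ltnn.
have lj (b : 'I_m * 'I_n) := ltn_ord b.2.
rewrite word_cons -scalerA.
have b' : borel_vector (a :: t) (f a *: (word f t *: w0)).
  apply: odd_reflection => // [i' lt|j' lt|b nb e|b nb e].
  - by apply: after; rewrite /odd_rank /=; have := lj a; nia.
  - by apply: after; rewrite /odd_rank /=; have := lj a; have := ltn_ord j'; nia.
  - have := before b nb; rewrite /odd_rank e => h; have := lj a.
    have : b.1 <> a.1.
      move=> e1; move: nb.
      by rewrite inE [b]surjective_pairing e e1 -surjective_pairing eqxx.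
    by move=> /eqP; rewrite -val_eqE /=; nia.
  - have := before b nb; rewrite /odd_rank e => h; have := lj a; have := lj b.
    have : b.2 <> a.2.
      move=> e1; move: nb.
      by rewrite inE [b]surjective_pairing e e1 -surjective_pairing eqxx.
    by move=> /eqP; rewrite -val_eqE /=; nia.
(* Applying e_a divided by the nonzero coefficient undoes the last reflection inside N. *)
split=> // Nw; apply: Nt; have [c [c0 hc]] := odd_reflection_coef bt ant.
have := NZ (sc c^-1 * E (lft a.1) (rgt a.2)) Nw.
by rewrite -scalerA hc scalerA -rmorphM mulVf // rmorph1 scale1r.
Qed.
End OddReflections.

(** * Generating by gl_down from 1 (x) M *)

Section DownSpan.
Variables (F : fieldType) (R : pzRingType) (sc : {rmorphism F -> R}).
Hypothesis scC : forall c u, sc c * u = u * sc c.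
Variables (m n : nat) (ev : 'M[F]_m -> 'M[F]_n -> R) (up : 'M[F]_(m, n) -> R).
Variable dn : 'M[F]_(n, m) -> R.
Hypothesis ev_dn : forall A D C, ev A D * dn C = dn C * ev A D + dn (D *m C - C *m A).
Hypothesis up_dn : forall B C, up B * dn C = ev (B *m C) (C *m B) - dn C * up B.
Variables (V : lmodType R) (M : zmodType) (base : M -> V).
Hypothesis base_sc : forall c v, exists w, sc c *: base v = base w.
Hypothesis base_ev : forall A D v, exists w, ev A D *: base v = base w.
Hypothesis base_up : forall B v, up B *: base v = 0.

(** Arbitrary C in gl_down are allowed, with no ordering, so that the commutation relations apply
    directly; [down_span_ext] turns this into ordered words in the letters. *)
Inductive down_span : V -> Prop :=
| down_span_base v : down_span (base v)
| down_span_dn C z : down_span z -> down_span (dn C *: z)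
| down_spanD z w : down_span z -> down_span w -> down_span (z + w).

Lemma down_span_sc c z : down_span z -> down_span (sc c *: z).
Proof.
elim=> [v|C w _ IH|w w' _ IH _ IH'].
- by have [w ->] := base_sc c v; exact: down_span_base.
- by rewrite scalerA scC -scalerA; exact: down_span_dn.
- by rewrite scalerDr; exact: down_spanD.
Qed.

Lemma down_span_ev A D z : down_span z -> down_span (ev A D *: z).
Proof.
elim=> [v|C w hw IH|w w' _ IH _ IH'].
- by have [w ->] := base_ev A D v; exact: down_span_base.
- rewrite scalerA ev_dn scalerDl -scalerA.
  by apply: down_spanD; exact: down_span_dn.
- by rewrite scalerDr; exact: down_spanD.
Qed.

Lemma down_span_up B z : down_span z -> down_span (up B *: z).
Proof.
elim=> [v|C w hw IH|w w' _ IH _ IH'].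
- rewrite base_up -(scale0r (base v)) -(rmorph0 sc).
  by apply: down_span_sc; exact: down_span_base.
- rewrite scalerA up_dn scalerBl -(scalerA (dn C)) -scaleN1r -(rmorphN1 sc).
  apply: down_spanD; first exact: down_span_ev.
  by apply: down_span_sc; exact: down_span_dn.
- by rewrite scalerDr; exact: down_spanD.
Qed.

Variables (f : 'I_m * 'I_n -> R) (s : seq ('I_m * 'I_n)).
Hypothesis fC : forall a b, f a * f b = - (f b * f a).
Hypothesis f2 : forall a, f a * f a = 0.
Hypothesis dnE : forall C, dn C = \sum_a sc (C a.2 a.1) * f a.
Hypothesis baseD : {morph base : v w / v + w}.
Hypothesis s_all : forall a, a \in s.

Lemma down_span_ext z : down_span z -> ext_span f base s z.
Proof.
elim=> [v|C w hw IH|w w' _ IH _ IH'].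
- exact: ext_span_base.
- rewrite dnE scaler_suml; elim/big_ind: _ => [|u u'|a _].
  + by rewrite -(scale0r w) -(rmorph0 sc); exact: ext_spanZ.
  + exact: ext_spanD.
  + by rewrite -scalerA; apply: ext_spanZ => //; exact: ext_span_letter.
- exact: ext_spanD.
Qed.
End DownSpan.

Lemma central_scale (R : pzRingType) (V : lmodType R) (c u : R) (v : V) :
  c * u = u * c -> u *: (c *: v) = c *: (u *: v).
Proof. by move=> e; rewrite !scalerA e. Qed.

Lemma twisted_scale (R : pzRingType) (V : lmodType R) (x u c : R) (v : V) :
  x * u = u * x + c * u -> u *: (x *: v) = x *: (u *: v) - c *: (u *: v).
Proof. by move=> e; rewrite !scalerA -scalerBl e addrK. Qed.

(** * The Kac module: spanning set and top layer *)

Section KacModule.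
Variables (F : fieldType) (m n p : nat) (chi : {scalar subvs_of (gl_even F m n)}).
Local Notation g := 'M[F]_(m + n).
Local Notation G := (gen p chi {:g}%VS).
Local Notation Ge := (gen p chi (gl_even F m n)).
Local Notation sc := (red_scal {:g}%VS p chi).
Local Notation sce := (red_scal (gl_even F m n) p chi).

Definition gen_even A D : redenv {:g}%VS p chi := G (block_mx A 0 0 D).
Definition gen_up B : redenv {:g}%VS p chi := G (block_mx 0 B 0 0).
Definition gen_down C : redenv {:g}%VS p chi := G (block_mx 0 0 C 0).

Lemma gen_block A B C D :
  G (block_mx A B C D) = gen_even A D + (gen_up B + gen_down C).
Proof. by rewrite -!genD !add_block_mx !addr0 !add0r. Qed.

Lemma block_up_gl_up (B : 'M[F]_(m, n)) : (block_mx 0 B 0 0 : g) \in gl_up F m n.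
Proof.
apply/mem_unit_span => i j; case: (split_ordP i) => i' ->; case: (split_ordP j) => j' ->.
- by rewrite block_mxEul mxE.
- by rewrite /= leq_addr.
- by rewrite block_mxEdl mxE.
- by rewrite block_mxEdr mxE.
Qed.

Lemma delta_gl_up (i : 'I_m) (j : 'I_n) :
  delta_mx (lshift n i) (rshift m j) \in gl_up F m n.
Proof.
apply/mem_unit_span => k l kl; rewrite mxE; case: eqP => // ek; case: eqP => // el.
by move: kl; rewrite ek el /= leq_addr ltn_ord.
Qed.

Lemma block_up_odd B : (block_mx 0 B 0 0 : g) \in gl_par F m n true.
Proof. exact: (subvP (addvSl _ _) _ (block_up_gl_up B)). Qed.

Lemma block_down_odd C : (block_mx 0 0 C 0 : g) \in gl_par F m n true.
Proof.
apply: (subvP (addvSr _ _)).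
apply/mem_unit_span => i j; case: (split_ordP i) => i' ->; case: (split_ordP j) => j' ->.
- by rewrite block_mxEul mxE.
- by rewrite block_mxEur mxE.
- by rewrite /= leq_addr.
- by rewrite block_mxEdr mxE.
Qed.

Lemma gen_even_down A D C :
  gen_even A D * gen_down C = gen_down C * gen_even A D + gen_down (D *m C - C *m A).
Proof.
have := @gen_bracket F m n p chi {:g}%VS false true (block_mx A 0 0 D) (block_mx 0 0 C 0)
  (memvf _) (memvf _) (memvf _) (diag_gl_even A D) (block_down_odd C).
rewrite mul1r /sbracket scale1r !mulmx_block !mul0mx !mulmx0 !addr0 !add0r.
rewrite opp_block_mx add_block_mx !oppr0 !addr0.
by rewrite /gen_down /gen_even => <-; rewrite addrC subrK.
Qed.

Lemma gen_up_down B C :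
  gen_up B * gen_down C = gen_even (B *m C) (C *m B) - gen_down C * gen_up B.
Proof.
have := @gen_bracket F m n p chi {:g}%VS true true (block_mx 0 B 0 0) (block_mx 0 0 C 0)
  (memvf _) (memvf _) (memvf _) (block_up_odd B) (block_down_odd C).
rewrite expr1 mulN1r opprK /sbracket expr1 scaleN1r opprK.
rewrite !mulmx_block !mul0mx !mulmx0 !addr0 !add0r.
by rewrite add_block_mx !addr0 !add0r /gen_up /gen_down /gen_even => <-; rewrite addrK.
Qed.

Local Notation f := (down_letter (fun i j => G (delta_mx i j))).

Lemma gen_downE C : gen_down C = \sum_a sc (C a.2 a.1) * f a.
Proof.
rewrite /gen_down.
have -> : block_mx 0 0 C 0 =
    \sum_(a : 'I_m * 'I_n) C a.2 a.1 *: (delta_mx (rshift m a.2) (lshift n a.1) : g).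
  apply/matrixP => i j; rewrite summxE.
  case: (split_ordP i) => i' ->; case: (split_ordP j) => j' ->.
  - rewrite block_mxEul mxE big1 // => a _.
    by rewrite !mxE eq_lrshift mulr0.
  - rewrite block_mxEur mxE big1 // => a _.
    by rewrite !mxE eq_lrshift mulr0.
  - rewrite block_mxEdl (bigD1 (j', i')) //= big1 => [|[a b] ab].
      by rewrite !mxE !eqxx mulr1 addr0.
    rewrite !mxE eq_lshift eq_rshift /=; case: eqP => [e|]; last by rewrite mulr0.
    case: eqP => [e'|]; last by rewrite mulr0.
    by rewrite e e' eqxx in ab.
  - rewrite block_mxEdr mxE big1 // => a _.
    by rewrite !mxE eq_rlshift andbF mulr0.
by rewrite gen_sum; apply: eq_bigr => a _; rewrite genZ.
Qed.

Lemma gen_down_delta a : gen_down (delta_mx a.2 a.1) = f a.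
Proof.
rewrite gen_downE (bigD1 a isT) big1 => [|b /andP[_ ba]].
  by rewrite mxE !eqxx rmorph1 mul1r Monoid.mulm1.
rewrite mxE; case: eqP => [e2|_]; last by rewrite rmorph0 mul0r.
case: eqP => [e1|_]; last by rewrite rmorph0 mul0r.
by move: ba; rewrite [b]surjective_pairing e1 e2 -surjective_pairing eqxx.
Qed.

Lemma gen_even_letter x a : x \in gl_even F m n -> exists k : 'I_m * 'I_n -> F,
  G x * f a = f a * G x + \sum_b sc (k b) * f b.
Proof.
move=> /gl_even_diag ->; set A := ulsubmx x; set D := drsubmx x.
exists (fun b => (D *m delta_mx a.2 a.1 - delta_mx a.2 a.1 *m A) b.2 b.1).
by rewrite -gen_downE -gen_down_delta; exact: gen_even_down.
Qed.

(** As a matrix h_alpha is idempotent, so it is fixed by the p-mapping. *)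
Lemma gen_h_root_pow (i : 'I_m) (j : 'I_n) : (0 < p)%N ->
  (G (delta_mx (lshift n i) (lshift n i)) + G (delta_mx (rshift m j) (rshift m j))) ^+ p
  = G (delta_mx (lshift n i) (lshift n i)) + G (delta_mx (rshift m j) (rshift m j))
    + sc (chi (vsproj (gl_even F m n) (h_root F i j)) ^+ p).
Proof.
move=> p0; rewrite -!genD -/(h_root F i j).
have h2 : h_root F i j * h_root F i j = h_root F i j.
  rewrite /h_root mulrDl !mulrDr ![_ * _]mul_delta_mx_cond !eqxx eq_lrshift eq_rlshift.
  by rewrite !mulr0n !mulr1n addr0 add0r.
have hq q : (0 < q)%N -> h_root F i j ^+ q = h_root F i j.
  by elim: q => // -[|q] IH _; rewrite ?expr1 // exprS IH.
have he := h_root_gl_even F i j.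
by have := @gen_pow F m n p chi {:g}%VS _ he (memvf _) (memvf _); rewrite hq.
Qed.

Hypothesis two_neq0 : (2%:R : F) != 0.

Let scC c u : sc c * u = u * sc c. Proof. exact: red_scalC. Qed.
Let fC : forall a b, f a * f b = - (f b * f a).
Proof. exact: down_letterC (@gen_delta F m n p chi). Qed.
Let f2 : forall a, f a * f a = 0.
Proof. exact: (@down_letter2 F _ sc m n _ two_neq0 (@gen_delta F m n p chi)). Qed.

Variable M : lmodType (redenv (gl_even F m n) p chi).
Local Notation Z := (kac_module M).
Local Notation base := (@kac_tens F m n p chi M 1).

Lemma kac_tensE a v : kac_tens a v = a *: base v.
Proof. by rewrite /kac_tens tensZ mulr1. Qed.

Lemma kac_baseD : {morph base : v w / v + w}.
Proof. by move=> v w; rewrite /kac_tens tensDr. Qed.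

Lemma kac_base0 : base 0 = 0.
Proof. by apply: (addIr (base 0)); rewrite -kac_baseD !add0r. Qed.

Lemma kac_down_span z : down_span gen_down base z.
Proof.
elim/kac_ind: z => [z z'|a v]; first exact: down_spanD.
have base_sc c w : exists w', sc c *: base w = base w'.
  by exists (sce c *: w); rewrite kac_tens_scal.
have base_ev A D w : exists w', gen_even A D *: base w = base w'.
  by exists (Ge (block_mx A 0 0 D) *: w); rewrite kac_tens_even // diag_gl_even.
have base_up B w : gen_up B *: base w = 0 by rewrite kac_tens_up // block_up_gl_up.
rewrite kac_tensE; apply: redenv_submod => [||x w hw|]; last exact: down_span_base.
- exact: down_spanD.
- exact: (down_span_sc scC base_sc).
- rewrite red_genE -[vsval x]submxK gen_block scalerDl.
  apply: down_spanD.
    exact: (down_span_ev gen_even_down base_ev).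
  rewrite scalerDl; apply: down_spanD; last exact: down_span_dn.
  exact: (down_span_up scC gen_even_down gen_up_down base_sc base_ev base_up).
Qed.

Lemma kac_ext_span s z : (forall a, a \in s) -> ext_span f base s z.
Proof.
move=> s_all.
apply: (down_span_ext scC _ fC f2 gen_downE kac_baseD s_all) (kac_down_span z).
by move=> c w; exists (sce c *: w); rewrite kac_tens_scal.
Qed.

(** An even x satisfies x f_top = f_top x + c f_top, so f_top (x) xv is a combination of x (f_top
    (x) v) and f_top (x) v, both in N. *)
Lemma top_stable (N : Z -> Prop) s : (forall a, a \in s) ->
  (forall z w, N z -> N w -> N (z + w)) -> (forall a z, N z -> N (a *: z)) ->
  forall u v, N (word f s *: base v) -> N (word f s *: base (u *: v)).
Proof.
move=> s_all ND NZ.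
apply: (redenv_submod (N := fun v => N (word f s *: base v)))
  => [v w hv hw|c v hv|x v hv].
- by rewrite kac_baseD scalerDr; apply: ND.
- by rewrite -kac_tens_scal central_scale //; exact: NZ.
have xe := subvsP x.
have [k hk] := choice (fun a => @gen_even_letter _ a xe).
have [c hc] := top_word_character scC fC f2 s_all hk.
rewrite red_genE -kac_tens_even // (twisted_scale _ hc).
by apply: ND; [|rewrite -scaleNr]; apply: NZ.
Qed.
End KacModule.

(** * Simplicity: reaching the top layer and returning *)

Theorem theorem4p4 (F : closedFieldType) (p m n : nat)
    (charF : p \in [pchar F]) (p_gt3 : (3 < p)%N) (mn_neq11 : (m, n) <> (1, 1)%N)
    (chi : {scalar subvs_of (gl_even F m n)})
    (chi_ss : semisimple_char chi)
    (chi_roots : forall (i : 'I_m) (j : 'I_n),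
       chi (vsproj (gl_even F m n) (h_root F i j)) <> 0)
    (M : lmodType (redenv (gl_even F m n) p chi)) (dM : bool -> M -> Prop)
    (M_graded : graded_module (@red_par F m n (gl_even F m n) p chi) dM)
    (M_simple : graded_simple dM) :
  graded_simple (kac_par dM).
Proof.
have p_prime := pcharf_prime charF.
have p_odd : odd p by case: (even_prime p_prime) p_gt3 => [->|].
have two_neq0 : (2%:R : F) != 0 by rewrite -(dvdn_pcharf charF) gtnNdvd // ltnW.
have p_gt1 := prime_gt1 p_prime.
case: (M_simple) => -[v0 v0_neq0] _; split.
  by exists (kac_tens 1 v0); apply: kac_tens1_neq0.
move=> N [N0 ND NZ _].
have [allN|someN] := pselect (forall v, N v -> v = 0); [by left | right].
have [z Nz z_neq0] : exists2 z, N z & z <> 0.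
  apply: contrapT => no; apply: someN => z Nz; apply: contrapT => z0.
  by apply: no; exists z.
(* Pushing z to the top works for any listing of the roots; the sorted one is what the reflections
   require. *)
pose r (a b : 'I_m * 'I_n) := (odd_rank a <= odd_rank b)%N.
pose s := sort r (enum {: 'I_m * 'I_n}).
have s_all a : a \in s by rewrite mem_sort mem_enum.
have s_uniq : uniq s by rewrite sort_uniq enum_uniq.
have s_pw : pairwise r s.
  rewrite -sorted_pairwise; last by move=> b a c; exact: leq_trans.
  by apply: sort_sorted => a b; exact: leq_total.
pose f := down_letter (fun i j => gen p chi {:'M[F]_(m + n)}%VS (delta_mx i j)).
have fC a b : f a * f b = - (f b * f a).
  exact: down_letterC (@gen_delta F m n p chi) a b.
have f2 a : f a * f a = 0.
  exact: (@down_letter2 F _ (red_scal _ p chi) m n _ two_neq0 (@gen_delta F m n p chi)).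
have baseD := @kac_baseD F m n p chi M.
have [t [v [v_neq0 hv]]] :=
  ext_span_top fC f2 baseD (kac_ext_span two_neq0 z s_all) z_neq0.
have Nv : N (word f s *: kac_tens 1 v) by rewrite -hv; apply: NZ.
(* The vector v reached from z is arbitrary; simplicity of M gives the whole top layer, in
   particular the term of a highest weight vector. *)
have top_all := simple_even_ungraded M_graded M_simple
  (N := fun v => N (word f s *: kac_tens 1 v)) _ (top_stable two_neq0 s_all ND NZ)
  Nv v_neq0.
have {}top_all w : N (word f s *: kac_tens 1 w).
  by apply: top_all => x y hx hy; rewrite baseD scalerDr; apply: ND.
have [w [w_neq0 w_pos w_diag]] := highest_weight_vector p_gt1 chi_ss v_neq0.
have Nw : N (kac_tens 1 w).
  have := odd_reflections (sc := red_scal _ p chi) (@red_scalC _ _ _ _ p chi)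
    two_neq0 (prime_gt0 p_prime) (@gen_delta F m n p chi)
    (chi := fun i j => chi (vsproj (gl_even F m n) (h_root F i j)) ^+ p) _ _ NZ
    (kac_tens1_neq0 charF p_odd w_neq0) _ _ _ (s := [::]) s_uniq s_all s_pw.
  move=> h; apply: (proj2 (h _ _ _ _ _)) => //.
  - by move=> i j; rewrite expf_neq0 //; apply/eqP.
  - by move=> i j; apply: gen_h_root_pow; exact: prime_gt0.
  - move=> k l kl /negPn ekl; rewrite kac_tens_even ?delta_gl_even // w_pos //.
    exact: kac_base0.
  - by move=> i j; rewrite kac_tens_up // delta_gl_up.
  - move=> k; have [c hc] := w_diag k; exists c.
    rewrite kac_tens_even ?hc ?kac_tens_scal //.
    by apply: delta_gl_even.
(* Simplicity of M a second time, now for the v with 1 (x) v in N; then 1 (x) M generates Z. *)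
have base_all := simple_even_ungraded M_graded M_simple (N := fun v => N (kac_tens 1 v)).
elim/kac_ind => [x y|a x]; first exact: ND.
rewrite kac_tensE; apply: (NZ a); apply: base_all Nw w_neq0 x => [x y hx hy|u x hx].
  by rewrite baseD; apply: ND.
apply: (redenv_submod (N := fun v => N (kac_tens 1 v))) hx
  => [x' y hx hy|c x' hx|x' y hx].
- by rewrite baseD; apply: ND.
- by rewrite -kac_tens_scal; apply: NZ.
- by rewrite red_genE -kac_tens_even ?subvsP //; apply: NZ.
Qed.
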